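(* Let $\mathcal{E}_A$ be the exponential family associated with a matrix $A \in \mathbb{Z}^{(n+1)\times(N+1)}$, and let $\mathcal{M}_r(\mathcal{E}_A)$ denote its $r$th mixture model. Let $r_1,\ldots,r_m\ge 1$ be integers and $R=\sum_{k=1}^m(r_k-1)+1$. Then the dimension of the $R$th mixture model $\mathcal{M}_R(\mathcal{E}_A)$ is a lower bound for the dimension of the Hadamard product of mixture models $\mathcal{M}_{r_1}(\mathcal{E}_A)\star \cdots \star \mathcal{M}_{r_m}(\mathcal{E}_A)$.
   Context: Let $\alpha_0,\ldots,\alpha_N$ be the columns of $A$. The exponential family $\mathcal{E}_A$ is the set of strictly positive probability vectors $p_\eta=(p_{\eta,0},\ldots,p_{\eta,N})$ with $p_{\eta,j}=\exp(\eta\cdot\alpha_j)/\sum_{i=0}^N\exp(\eta\cdot\alpha_i)$, for $\eta\in\mathbb{R}^{n+1}$ (i.e., up to normalization, the image of the monomial map $\mathbf{x}\mapsto(\mathbf{x}^{\alpha_0},\ldots,\mathbf{x}^{\alpha_N})$ precomposed with the coordinate-wise exponential). The $r$th mixture model $\mathcal{M}_r(\mathcal{E})$ is the set of all convex combinations of $r$ elements of $\mathcal{E}$. The Hadamard product of models is the set of all entry-wise products of one element from each model, normalized so that the entries sum to one. Dimension means dimension as a (semialgebraic) subset of the probability simplex in $\mathbb{R}^{N+1}$. *)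

(* Defs.v *)
From HB Require Import structures.
From mathcomp Require Import all_boot all_order all_algebra.
From mathcomp Require Import ring_quotient.
From mathcomp Require Import all_classical all_reals all_analysis.
(* The notations of mpoly and of mathcomp-analysis are incompatible. *)
From mathcomp Require Import -(notations) mpoly.

Set Implicit Arguments.
Unset Strict Implicit.
Unset Printing Implicit Defensive.

Import Order.TTheory GRing.Theory Num.Theory.
Local Open Scope classical_set_scope.
Local Open Scope ring_scope.

Section Models.
Variable R : realType.

(* Points of R^n are row vectors; coordinates are indexed from 0. *)

Definition normalize n (v : 'rV[R]_n) : 'rV[R]_n := (\sum_j v 0 j)^-1 *: v.

(* (eta *m map_mx intr A) 0 j is the scalar product of eta with column j of A *)
Definition exp_family n N (A : 'M[int]_(n.+1, N.+1)) : set 'rV[R]_N.+1 :=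
  [set p | exists eta : 'rV[R]_n.+1,
     p = normalize (\row_j expR ((eta *m map_mx intr A) 0 j))].

Definition mixture n (r : nat) (E : set 'rV[R]_n) : set 'rV[R]_n :=
  [set p | exists (w : 'I_r -> R) (q : 'I_r -> 'rV[R]_n),
     [/\ forall i, 0 <= w i, \sum_i w i = 1, forall i, E (q i)
       & p = \sum_i w i *: q i]].

Definition hadamard n m (M : 'I_m -> set 'rV[R]_n) : set 'rV[R]_n :=
  [set p | exists2 q : 'I_m -> 'rV[R]_n, forall k, M k (q k)
     & p = normalize (\row_j \prod_k q k 0 j)].

(* Dimension of a semialgebraic set S of R^n (Bochnak, Coste and Roy, Real
   Algebraic Geometry, Definition 2.8.1): the Krull dimension of the ring
   R[X_1, ..., X_n] / I(S) of polynomial functions on S.  Prime ideals of this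
   quotient are represented by the prime ideals of R[X_1, ..., X_n] that
   contain I(S). *)

Definition vanishing_ideal n (S : set 'rV[R]_n) : {pred mpoly n R} :=
  [pred f : mpoly n R | `[< forall x, S x -> meval (fun j => x 0 j) f = 0 >]].

(* P 0, ..., P d is a strictly increasing chain of d.+1 prime ideals above I;
   idealr_closed includes properness (1 is not in the ideal). *)
Definition prime_chain n (I : {pred mpoly n R}) (d : nat)
    (P : nat -> {pred mpoly n R}) : Prop :=
  [/\ forall i, (i <= d)%N ->
        [/\ idealr_closed (P i), prime_idealr_closed (P i)
          & {subset I <= P i}]
    & forall i, (i < d)%N -> {subset P i <= P i.+1} /\
        exists2 f, f \in P i.+1 & f \notin P i].

(* The supremum is taken in the extended reals, so that no a priori bound on
   the length of chains is built in; the empty set has dimension -oo. *)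
Definition semialg_dim n (S : set 'rV[R]_n) : \bar R :=
  ereal_sup [set (d%:R)%:E | d in
    [set d : nat | exists P, prime_chain (vanishing_ideal S) d P]].

End Models.

(* Main.v *)
Require Import Defs.
From mathcomp Require Import all_boot all_order all_algebra.
From mathcomp Require Import all_classical all_reals all_analysis.
From mathcomp Require Import ring_quotient.
From mathcomp Require Import -(notations) mpoly.
From mathcomp Require Import zify.

(** Both models are normalizations of the image of a polynomial map Psi with
    positive coefficients: after translating the rows of A we may assume that its
    entries are nonnegative, so that E_A is parametrized by monomials.  For such
    an image the Krull dimension is the maximum over t of the rank of Psi(t)
    together with the first derivatives of Psi at t, minus one.

    Upper bound: let t0 attain the maximal rank k+1 and take k+1 or more elements
    f_j in P_(j+1) \ P_j of a prime chain.  Monomials in the f_j are linearly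
    independent modulo P_0.  On a k-dimensional slice through t0 that is transverse
    to the fibres, counting monomials yields a polynomial G in the f_j which
    vanishes on the slice.  By maximality of the rank, any further derivative of G is
    a combination of G and its derivatives along the slice, so the lowest
    coefficient of G transverse to the slice has to vanish, and G vanishes on the
    whole image.

    Lower bound: nested slices through a point of rank at least d+1 give a chain of
    vanishing ideals, which are prime because a slice is an affine space.  Counting
    gives a polynomial in i+1 suitable linear forms that vanishes on the i-dimensional
    slice; it does not vanish on the (i+1)-dimensional one, as its lowest
    form around the base point would vanish on all tangent vectors.

    Comparison: at the point (x_0; x_1 / x_0, ..., x_(R-1) / x_0) with all weights of the
    non-leading terms zero, the derivatives of
      x_0^alpha * prod_k (1 + sum_i u_(k,i) x_(k,i)^alpha)
    in the directions u_i, and those in the directions x_i divided by the weights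
    u_i, span the tangent space of the R-th mixture map at (x_0, ..., x_(R-1)).  By
    semicontinuity the rank is at least as large at some point with positive
    weights. *)

Set Implicit Arguments.
Unset Strict Implicit.
Unset Printing Implicit Defensive.

Import Order.TTheory GRing.Theory Num.Theory.
Local Open Scope ring_scope.

Local Notation "''X_' i" := (mpolyX _ (mnm1 i))
  (at level 8, i at level 2, format "''X_' i").

(** * Polynomials: vanishing on the positive orthant and the chain rule *)

Lemma mpoly_ring_ind (n : nat) (R : comNzRingType) (P : mpoly n R -> Prop) :
  (forall c, P (mpolyC n c)) -> (forall i, P 'X_i) ->
  (forall p q, P p -> P q -> P (p + q)) ->
  (forall p q, P p -> P q -> P (p * q)) -> forall p, P p.
Proof.
move=> PC PX PD PM p; rewrite (mpolyE p).
elim/big_ind: _ => //; first by rewrite -(mpolyC0 n R).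
move=> m _; rewrite -mul_mpolyC; apply: (PM) => //.
rewrite mpolyXE_id; elim/big_ind: _ => //; first by rewrite -(mpolyC1 n R).
move=> i _; elim: (m i) => [|k IHk]; first by rewrite expr0 -(mpolyC1 n R).
by rewrite exprS; apply: PM.
Qed.

Lemma poly_eq0_of_pos (R : numDomainType) (p : {poly R}) :
  (forall x, 0 < x -> p.[x] = 0) -> p = 0.
Proof.
move=> p0; apply/eqP; apply: contraT => nz_p.
have := @max_poly_roots _ p [seq i.+1%:R | i <- iota 0 (size p)] nz_p.
rewrite size_map size_iota ltnn; apply; last first.
  by rewrite map_inj_uniq ?iota_uniq // => i j /eqP; rewrite eqr_nat => /eqP [].
by apply/allP => _ /mapP[i _ ->]; rewrite /root p0 ?ltr0Sn.
Qed.

(** Isolating the last variable turns statements about several variables into univariate ones by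
    induction. Injectivity of [U] is stated through its kernel, which is what the induction uses. *)
Lemma mpoly_last_var (R : comNzRingType) n :
  exists2 U : mpoly n.+1 R -> {poly mpoly n R}, (forall p, U p = 0 -> p = 0)
    & forall v p, meval v p = (map_poly (meval (v \o lift ord_max)) (U p)).[v ord_max].
Proof.
pose X (i : 'I_n.+1) : {poly mpoly n R} :=
  if unlift ord_max i is Some j then ('X_j)%:P else 'X.
pose U : {rmorphism mpoly n.+1 R -> {poly mpoly n R}} := mmap (polyC \o @mpolyC n R) X.
pose W : {rmorphism mpoly n R -> mpoly n.+1 R} :=
  mmap (@mpolyC _ R) (fun j => 'X_(lift ord_max j)).
pose WP : {rmorphism {poly mpoly n R} -> {poly mpoly n.+1 R}} := map_poly W.
have UC c : U (mpolyC _ c) = (mpolyC _ c)%:P by exact: mmapC.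
have UX i : U 'X_i = X i by rewrite [LHS]mmapX mmap1U.
(* Substituting the last variable back for ['X] is a left inverse of [U]. *)
have UK q : (WP (U q)).['X_ord_max] = q.
  elim/mpoly_ring_ind: q => [c|i|q r IHq IHr|q r IHq IHr].
  - by rewrite UC [WP _]map_polyC hornerC [LHS]mmapC.
  - rewrite UX /X; case: unliftP => [j ->|->].
      by rewrite [WP _]map_polyC hornerC [LHS]mmapX mmap1U.
    by rewrite [WP _]map_polyX hornerX.
  - by rewrite (rmorphD U) (rmorphD WP) hornerD; exact: (congr2 _ IHq IHr).
  - by rewrite (rmorphM U) (rmorphM WP) hornerM; exact: (congr2 _ IHq IHr).
have UE v q : meval v q = (map_poly (meval (v \o lift ord_max)) (U q)).[v ord_max].
  pose V : {rmorphism mpoly n R -> R} := meval (v \o lift ord_max).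
  pose VP : {rmorphism {poly mpoly n R} -> {poly R}} := map_poly V.
  rewrite -[map_poly _ _]/(VP (U q)).
  elim/mpoly_ring_ind: q => [c|i|q r IHq IHr|q r IHq IHr].
  - by rewrite UC [VP _]map_polyC hornerC [RHS]mevalC mevalC.
  - rewrite UX mevalXU /X; case: unliftP => [j ->|->].
      by rewrite [VP _]map_polyC hornerC [RHS]mevalXU.
    by rewrite [VP _]map_polyX hornerX.
  - by rewrite (rmorphD U) (rmorphD VP) hornerD mevalD; exact: (congr2 _ IHq IHr).
  - by rewrite (rmorphM U) (rmorphM VP) hornerM mevalM; exact: (congr2 _ IHq IHr).
exists U => // p U0; by rewrite -[p]UK U0 (rmorph0 WP) horner0.
Qed.

(** Induction on the number of variables: at a fixed positive [v] the univariate polynomial in the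
    last variable has all positive numbers as roots, so each of its coefficients vanishes at [v]. *)
Lemma mpoly_eq0_of_pos (R : numDomainType) n (p : mpoly n R) :
  (forall v, (forall i, 0 < v i) -> meval v p = 0) -> p = 0.
Proof.
elim: n p => [|n IHn] p p0.
  have [c p_c] : exists c, p = mpolyC 0 c.
    elim/mpoly_ring_ind: p {p0} => [c|[]//|_ _ [c ->] [d ->]|_ _ [c ->] [d ->]].
    - by exists c.
    - by exists (c + d); rewrite mpolyCD.
    - by exists (c * d); rewrite mpolyCM.
  have := p0 (fun=> 1) (fun=> ltr01).
  by rewrite p_c [meval _ _]mevalC => ->; rewrite mpolyC0.
have [U U0 UE] := mpoly_last_var R n.
apply: U0; apply/polyP => k; rewrite coef0; apply: IHn => v v_gt0.
rewrite -coef_map /= [map_poly _ _]poly_eq0_of_pos ?coef0 // => x x_gt0.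
pose w i := if unlift ord_max i is Some j then v j else x.
have := UE w p; rewrite p0; last by move=> i; rewrite /w; case: unliftP.
rewrite {2}/w unlift_none => ->; congr (_.[x]).
by apply: eq_map_poly => q; apply: meval_eq => j; rewrite /w /= liftK.
Qed.

(** The chain rule for an abstract derivation, so that it applies both to [deriv] on [{poly _}] and
    to [mderiv] taken coefficientwise. *)
Lemma derivation_mmap (R A : comNzRingType) (f : {rmorphism R -> A}) n (h : 'I_n -> A)
    (D : A -> A) :
  (forall x y, D (x + y) = D x + D y) -> (forall x y, D (x * y) = D x * y + x * D y) ->
  (forall c, D (f c) = 0) ->
  forall p, D (mmap f h p) = \sum_i mmap f h (mderiv i p) * D (h i).
Proof.
move=> DD DM Df p; elim/mpoly_ring_ind: p => [c|i|p q IHp IHq|p q IHp IHq].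
- by rewrite mmapC Df big1 // => i _; rewrite mderivC mmap0 mul0r.
- rewrite mmapX mmap1U (bigD1 i) //= big1 ?addr0.
    by rewrite mderivX mnmE eqxx scale1r -{1}[mnm1 i]add0m addmK mmapX mmap11 mul1r.
  move=> j ji; rewrite mderivX mnmE eq_sym (negbTE ji) scale0r.
  by rewrite mmap0 mul0r.
- rewrite mmapD DD IHp IHq -big_split; apply: eq_bigr => i _ /=.
  by rewrite mderivD mmapD mulrDl.
- rewrite [mmap f h (p * q)]rmorphM DM IHp IHq mulr_suml mulr_sumr -big_split.
  apply: eq_bigr => i _ /=; rewrite mderivM mmapD !rmorphM /= mulrDl.
  by rewrite mulrAC -!mulrA.
Qed.

(** * Linear algebra: dual frames and linear dependence by counting *)

Lemma rank_frame (F : fieldType) m n d (A : 'M[F]_(m, n)) : (d <= \rank A)%N ->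
  exists V : 'M[F]_(d, m), exists W : 'M[F]_(n, d), V *m A *m W = 1%:M.
Proof.
move=> rkA; exists (pid_mx d *m invmx (col_ebase A)), (invmx (row_ebase A) *m pid_mx d).
rewrite -[X in _ *m X *m _](mulmx_ebase A) !mulmxA mulmxKV ?col_ebase_unit //.
rewrite mulmxK ?row_ebase_unit //.
have dm : (d <= m)%N by exact: leq_trans rkA (rank_leq_row _).
have dn : (d <= n)%N by exact: leq_trans rkA (rank_leq_col _).
by rewrite !mul_pid_mx -pid_mx_1; congr pid_mx; lia.
Qed.

(** Dividing by the line of [y] lowers the rank by at most one, so a frame of size [d] survives. The
    rows of [V] are directions in parameter space; the columns of [W] are linear forms that kill [y]
    and are dual to the images of these directions under [J]. *)
Lemma dual_frame (F : fieldType) k n d (y : 'rV[F]_n) (J : 'M[F]_(k, n)) :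
  (d < \rank (col_mx y J))%N ->
  exists V : 'M[F]_(d, k), exists W : 'M[F]_(n, d), y *m W = 0 /\ V *m J *m W = 1%:M.
Proof.
move=> rkJ; set C := cokermx y.
have yC : y *m C = 0 by exact: mulmx_coker.
have rkC : (n.-1 <= \rank C)%N.
  rewrite mxrank_coker -subn1; apply: leq_sub2l.
  exact: rank_leq_row.
have rkJC : (d <= \rank (J *m C))%N.
  have := mxrank_mul_min (col_mx y J) C; rewrite mul_col_mx yC => h.
  have rk0 : \rank (col_mx (0 : 'rV[F]_n) (J *m C)) = \rank (J *m C).
    by rewrite -addsmxE adds0mx.
  have le_n : (\rank (col_mx y J) <= n)%N by exact: rank_leq_col.
  rewrite rk0 in h; lia.
have [V [W VJCW]] := rank_frame rkJC.
exists V, (C *m W); rewrite mulmxA yC mul0mx; split=> //.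
by rewrite mulmxA -(mulmxA V).
Qed.

(** All exponents that occur are below [b], so the polynomials lie in a space spanned by [b ^ k]
    monomials. *)
Lemma mpoly_lin_dep (F : fieldType) k (I : finType) (p : I -> mpoly k F) b :
  (forall i, (msize (p i) <= b)%N) -> (b ^ k < #|I|)%N ->
  exists2 c : I -> F, (exists i, c i != 0) & \sum_i c i *: p i = 0.
Proof.
move=> szp ltI.
pose M : 'M[F]_(#|I|, #|{: {ffun 'I_k -> 'I_b}}|) :=
  \matrix_(i, e)
    mcoeff (Multinom [tuple ((enum_val e : {ffun 'I_k -> 'I_b}) l : nat) | l < k])
      (p (enum_val i)).
have : kermx M != 0.
  rewrite -mxrank_eq0 mxrank_ker -lt0n subn_gt0.
  apply: leq_ltn_trans (rank_leq_col _) _.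
  by rewrite card_ffun !card_ord.
case/rowV0Pn => u /submxP[w ->]; set v := w *m _ => nz_v.
have vM : v *m M = 0 by rewrite /v -mulmxA mulmx_ker mulmx0.
exists (fun i => v 0 (enum_rank i)).
  have /rV0Pn[i nz] := nz_v.
  by exists (enum_val i); rewrite enum_valK.
apply/mpolyP => m; rewrite mcoeff0 linear_sum /=.
case: (boolP [forall l, (m l < b)%N]) => [/forallP lt_m|].
  pose e : {ffun 'I_k -> 'I_b} := [ffun l => Ordinal (lt_m l)].
  have := congr1 (fun A : 'M[F]_(_, _) => A 0 (enum_rank e)) vM.
  rewrite !mxE (reindex enum_rank) /=; last by apply: onW_bij; apply: enum_rank_bij.
  move=> vM0; rewrite -[RHS]vM0; apply: eq_bigr => i _; rewrite linearZ /= !mxE enum_rankK.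
  congr (_ * mcoeff _ _).
    by apply/mnmP => l; rewrite mnmE ffunE.
  by rewrite enum_rankK.
rewrite negb_forall => /existsP[l]; rewrite -leqNgt => bm.
rewrite big1 // => i _; rewrite linearZ /= memN_msupp_eq0 ?mulr0 //.
apply/msize_mdeg_ge/(leq_trans (szp i))/(leq_trans bm).
by rewrite mdegE (bigD1 l) //= leq_addr.
Qed.

(** * Evaluation after homogenization *)

Section HomogeneousEvaluation.
Variables (F : fieldType) (n E : nat).

(* This is s ^ E * p (y / s), written without division. *)
Definition homog_eval (A : comNzRingType) (f : F -> A) (y : 'I_n -> A) (s : A)
    (p : mpoly n F) : A :=
  \sum_(m : bmultinom n E.+1) f (mcoeff m p) * (s ^+ (E - mdeg m) * mmap1 y m).

Lemma homog_eval_sum (A : comNzRingType) (f : {rmorphism F -> A}) y s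
    (I : finType) (c : I -> F) (p : I -> mpoly n F) :
  homog_eval f y s (\sum_i c i *: p i) = \sum_i f (c i) * homog_eval f y s (p i).
Proof.
rewrite /homog_eval; under [RHS]eq_bigr do rewrite mulr_sumr.
rewrite exchange_big; apply: eq_bigr => m _ /=.
rewrite linear_sum rmorph_sum mulr_suml; apply: eq_bigr => i _ /=.
by rewrite linearZ /= rmorphM -mulrA.
Qed.

Lemma rmorph_homog_eval (A B : comNzRingType) (f : F -> A) (g : {rmorphism A -> B}) y s p :
  g (homog_eval f y s p) = homog_eval (g \o f) (g \o y) (g s) p.
Proof.
rewrite /homog_eval rmorph_sum; apply: eq_bigr => m _ /=.
by rewrite !rmorphM rmorphXn rmorph_prod; under eq_bigr do rewrite rmorphXn.
Qed.

Lemma eq_homog_eval (A : comNzRingType) (f g : F -> A) (y z : 'I_n -> A) s t p :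
  f =1 g -> y =1 z -> s = t -> homog_eval f y s p = homog_eval g z t p.
Proof.
move=> fg yz ->; apply: eq_bigr => m _; rewrite fg; congr (_ * (_ * _)).
by apply: eq_bigr => i _; rewrite yz.
Qed.

Lemma homog_evalE (y : 'I_n -> F) s p : s != 0 -> (msize p <= E.+1)%N ->
  homog_eval idfun y s p = s ^+ E * meval (fun j => y j / s) p.
Proof.
move=> nz_s szp; rewrite {2}(mpolywE szp) raddf_sum mulr_sumr.
apply: eq_bigr => m _ /=; rewrite mevalZ mevalX mulrCA.
have le_mE : (mdeg m <= E)%N by rewrite -ltnS bmdeg.
have -> : s ^+ E = s ^+ (E - mdeg m) * s ^+ mdeg m by rewrite -exprD subnK.
rewrite -[RHS]mulrA [X in _ = _ * X]mulrCA; do 2 congr (_ * _); rewrite mdegE -prodrXr -big_split.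
by apply: eq_bigr => j _ /=; rewrite -exprMn mulrC divfK.
Qed.

Lemma msize_homog_eval k (y : 'I_n -> mpoly k F) s p d :
  (forall j, (msize (y j) <= d.+1)%N) -> (msize s <= d.+1)%N ->
  (msize (homog_eval (@mpolyC k F) y s p) <= (E * d).+1)%N.
Proof.
move=> szy szs.
have szM (q r : mpoly k F) a b :
    (msize q <= a.+1 -> msize r <= b.+1 -> msize (q * r) <= (a + b).+1)%N.
  have [->|nz_q] := eqVneq q 0; first by rewrite mul0r msize0.
  have [->|nz_r] := eqVneq r 0; first by rewrite mulr0 msize0.
  rewrite msizeM //; move: (msize q) (msize r) => u v; lia.
have szX (q : mpoly k F) e : (msize q <= d.+1 -> msize (q ^+ e) <= (e * d).+1)%N.
  move=> szq; elim: e => [|e IHe]; first by rewrite expr0 msize1.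
  by rewrite exprS mulSn; apply: szM.
apply: leq_trans (msize_sum _ _ _) _; apply/bigmax_leqP => m _.
rewrite mul_mpolyC; apply: leq_trans (msizeZ_le _ _) _.
have le_mE : (mdeg m <= E)%N by rewrite -ltnS bmdeg.
rewrite -[X in (X * d)%N](subnK le_mE) mulnDl; apply: (szM); first exact: szX.
rewrite mdegE big_distrl /mmap1 /=.
apply: (big_ind2 (fun (q : mpoly k F) a => msize q <= a.+1)%N) => [|q a r b|i _].
- by rewrite msize1.
- exact: szM.
- exact: szX.
Qed.

Definition is_derivation (A : comNzRingType) (f : F -> A) (D : A -> A) :=
  [/\ {morph D : x y / x + y}, forall x y, D (x * y) = D x * y + x * D y
    & forall c, D (f c) = 0].

(** Euler's principle: [homog_eval] is homogeneous of degree [E] in [y] and [s], so a first-order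
    linear relation shared by all [y j] and [s] passes to it, with the zero-order term multiplied by
    [E]. *)
Lemma derivation_homog_eval (A : comNzRingType) (f : {rmorphism F -> A}) (T : finType)
    (D : A -> A) (Dt : T -> A -> A) (a b0 : A) (b : T -> A) (y : 'I_n -> A) s p :
  is_derivation f D -> (forall t, is_derivation f (Dt t)) ->
  (forall j, a * D (y j) = b0 * y j + \sum_t b t * Dt t (y j)) ->
  a * D s = b0 * s + \sum_t b t * Dt t s ->
  let G := homog_eval f y s p in
  a * D G = b0 * G *+ E + \sum_t b t * Dt t G.
Proof.
move=> dD dDt hy hs /=.
(* The relation in weight [k]. Weights add up under products; constants have weight 0, the [y j] and
   [s] weight 1. *)
pose wt k g := a * D g = b0 * g *+ k + \sum_t b t * Dt t g.
have wtM k l g h : wt k g -> wt l h -> wt (k + l)%N (g * h).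
  have [_ DM _] := dD; rewrite /wt => wg wh.
  rewrite DM mulrDr mulrA wg mulrCA wh.
  rewrite (_ : \sum_t b t * Dt t (g * h) =
     (\sum_t b t * Dt t g) * h + g * \sum_t b t * Dt t h); first last.
    rewrite mulr_suml mulr_sumr -big_split; apply: eq_bigr => t _ /=.
    by have [_ -> _] := dDt t; rewrite mulrDr mulrA (mulrCA g).
  by rewrite mulrDl mulrDr addrACA mulrnDr mulrnAl mulrnAr -mulrA (mulrCA g b0).
have wtC c : wt 0%N (f c).
  have [_ _ Df] := dD; rewrite /wt Df mulr0 mulr0n add0r big1 // => t _.
  by have [_ _ ->] := dDt t; rewrite mulr0.
have wtX k g e : wt k g -> wt (e * k)%N (g ^+ e).
  move=> wg; elim: e => [|e IHe]; first by rewrite expr0 -(rmorph1 f); apply: wtC.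
  by rewrite exprS mulSn; apply: wtM.
have wt1 g : a * D g = b0 * g + \sum_t b t * Dt t g -> wt 1%N g by rewrite /wt mulr1n.
have wtD k g h : wt k g -> wt k h -> wt k (g + h).
  have [DD _ _] := dD; rewrite /wt => wg wh.
  rewrite DD mulrDr wg wh mulrDr mulrnDl addrACA; congr (_ + _).
  by rewrite -big_split; apply: eq_bigr => t _ /=; have [-> _ _] := dDt t; rewrite mulrDr.
have wt0 k : wt k 0.
  have D0 D' : is_derivation f D' -> D' 0 = 0.
    by case=> _ _ Df; rewrite -{1}(rmorph0 f) Df.
  rewrite /wt (D0 D) // !mulr0 mul0rn add0r big1 // => t _.
  by rewrite (D0 (Dt t)) // mulr0.
rewrite -[RHS]/(_ *+ E + _) -/(wt E _).
apply: (big_ind (wt E)) => // [|m _]; first exact: wtD.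
rewrite -[X in wt X]add0n; apply: (wtM) => //.
have le_mE : (mdeg m <= E)%N by rewrite -ltnS bmdeg.
rewrite -[X in wt X](subnK le_mE); apply: (wtM).
  by rewrite -[X in wt X]muln1; apply/wtX/wt1.
rewrite mdegE; apply: (big_ind2 (fun k g => wt k g)) => [|k g l h|i _].
- by rewrite -(rmorph1 f).
- exact: wtM.
- by rewrite -[X in wt X]muln1; apply/wtX/wt1.
Qed.

End HomogeneousEvaluation.

(** * Upper bound for the length of prime chains *)

(** There are [D ^ d] monomials in the [f i] with exponents below [D], whereas their pullbacks to
    [k] variables have degree linear in [D] and span a space of dimension of order [D ^ k] only. *)
Lemma homog_dep (F : fieldType) k d n (y : 'I_n -> mpoly k F) s (f : nat -> mpoly n F) :
  (k < d)%N ->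
  exists D E, exists c : {ffun 'I_d -> 'I_D} -> F,
    let p := \sum_e c e *: \prod_(i < d) f i ^+ e i in
    [/\ exists e, c e != 0, (msize p <= E.+1)%N & homog_eval E (@mpolyC k F) y s p = 0].
Proof.
move=> lt_kd.
pose a := (\max_j msize (y j) + msize s)%N; pose b := (\max_(i < d) msize (f i))%N.
(* [E] bounds the degrees of the monomials and [C * D] the sizes of their pullbacks. As [C] does not
   depend on [D], taking [D] above [C ^ k] gives [(C * D) ^ k < D ^ k.+1 <= D ^ d]. *)
pose C := (d * b * a).+1; pose D := (C ^ k).+1; pose E := (d * (D * b))%N.
pose f' (e : {ffun 'I_d -> 'I_D}) := \prod_(i < d) f i ^+ e i.
have szM (q r : mpoly n F) u v :
    (msize q <= u.+1 -> msize r <= v.+1 -> msize (q * r) <= (u + v).+1)%N.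
  have [->|nz_q] := eqVneq q 0; first by rewrite mul0r msize0.
  have [->|nz_r] := eqVneq r 0; first by rewrite mulr0 msize0.
  rewrite msizeM //; move: (msize q) (msize r) => ? ?; lia.
have szf e : (msize (f' e) <= E.+1)%N.
  rewrite (_ : E = \sum_(i < d) D * b)%N; last by rewrite sum_nat_const card_ord.
  apply: (big_ind2 (fun q u => msize q <= u.+1)%N) => [|q u r v|i _].
  - by rewrite msize1.
  - exact: szM.
  have le_b : (msize (f i) <= b.+1)%N.
    by apply: leqW; apply: (leq_bigmax (F := fun i : 'I_d => msize (f i))).
  have : (msize (f i ^+ e i) <= (e i * b).+1)%N.
    elim: (nat_of_ord (e i)) => [|m IHm]; first by rewrite expr0 msize1.
    by rewrite exprS mulSn; apply: szM.
  by move/leq_trans; apply; rewrite ltnS leq_mul2r ltnW ?orbT.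
have szH e : (msize (homog_eval E (@mpolyC k F) y s (f' e)) <= C * D)%N.
  apply: leq_trans (msize_homog_eval (d := a) _ _ _ _) _.
  - move=> j; rewrite ltnW // ltnS /a; apply: leq_trans (leq_addr _ _).
    exact: (leq_bigmax (F := fun i => msize (y i))).
  - by rewrite ltnW // ltnS leq_addl.
  rewrite /E /C mulSn.
  rewrite (_ : d * (D * b) * a = d * b * a * D)%N; last by rewrite !mulnA; lia.
  by rewrite -addn1 addnC leq_add2r.
have [|c nzc c0] := mpoly_lin_dep szH.
  rewrite card_ffun !card_ord expnMn.
  apply: (@leq_trans (D * D ^ k)%N); last by rewrite -expnS leq_pexp2l.
  by rewrite ltn_pmul2r ?expn_gt0.
exists D, E, c; split=> //.
  apply: leq_trans (msize_sum _ _ _) _; apply/bigmax_leqP => e _.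
  exact: leq_trans (msizeZ_le _ _) (szf e).
by rewrite homog_eval_sum -[RHS]c0; apply: eq_bigr => e _; rewrite mul_mpolyC.
Qed.

(** Uniqueness for a linear differential equation with zero initial value. In degree [k] the
    equation expresses [k.+1%:R * a_0 * G_(k+1)] through lower coefficients of [G], since the [D t]
    act coefficientwise. *)
Lemma poly_eq0_of_diff_eq (B : idomainType) (T : finType) (D : T -> B -> B) E
    (G a b0 : {poly B}) (b : T -> {poly B}) :
  (forall k, k.+1%:R != 0 :> B) -> (forall t, D t 0 = 0) ->
  a`_0 != 0 -> G`_0 = 0 ->
  a * G^`() = b0 * G *+ E + \sum_t b t * map_poly (D t) G -> G = 0.
Proof.
move=> char0 D0 nz_a G0 eqG; apply/polyP => k; rewrite coef0.
elim/ltn_ind: k => -[|k] IHk //.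
have := congr1 (coefp k) eqG; rewrite /= coefD coefMn coef_sum.
rewrite [(b0 * G)`_k]coefM big1 => [|i _]; last first.
  by rewrite (IHk (k - i)%N) ?mulr0 // ltnS leq_subr.
rewrite mul0rn add0r big1 => [|t _]; last first.
  rewrite coefM big1 // => i _; rewrite coef_map_id0 ?D0 //.
  by rewrite (IHk (k - i)%N) ?D0 ?mulr0 // ltnS leq_subr.
rewrite coefM big_ord_recl big1 => [|i _]; last first.
  rewrite coef_deriv IHk ?mul0rn ?mulr0 // lift0; have := ltn_ord i; lia.
move/eqP; rewrite addr0 subn0 coef_deriv mulf_eq0 (negbTE nz_a) -mulr_natr mulf_eq0.
by rewrite (negbTE (char0 k)) orbF => /eqP.
Qed.

(** If [a] is nonzero, [m] has rank [p] and hence the row space of [Q], so Cramer's rule expresses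
    [r] through [m]. The outer factor [a] makes the identity hold for [a = 0] too, so that it can be
    checked at every point and then cancelled generically. *)
Lemma cramer_row (F : fieldType) p q n (m : 'M[F]_(p, n)) (Q : 'M[F]_(q, n))
    (r : 'rV[F]_n) (w : 'M[F]_(n, p)) :
  (m <= Q)%MS -> (r <= Q)%MS -> (\rank Q <= p)%N ->
  let a := \det (m *m w) in a *: (a *: r - r *m w *m \adj (m *m w) *m m) = 0.
Proof.
move=> mQ rQ rkQ a; have [->|nz_a] := eqVneq a 0; first by rewrite scale0r.
have rkm : \rank m = p.
  apply/eqP; rewrite eqn_leq rank_leq_row.
  have /mxrank_unit {1}<- : m *m w \in unitmx by rewrite unitmxE unitfE.
  exact: mxrankM_maxl.
have /submxP[x ->] : (r <= m)%MS.
  apply: submx_trans rQ _.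
  by rewrite -(mxrank_leqif_sup mQ).2 eqn_leq mxrankS // rkm.
rewrite -!mulmxA (mulmxA m w) (mulmxA (m *m w)) mul_mx_adj mul_scalar_mx.
by rewrite scalemxAr subrr scaler0.
Qed.

(* Fix the exponents of f 0, f 1, ... one after the other, each time as small as
   possible: dividing by the power of f j and reducing modulo P j.+1 keeps only the
   monomials with that exponent of f j. *)
Lemma prime_chain_free (F : fieldType) n d (P : nat -> {pred mpoly n F})
    (f : nat -> mpoly n F) D (c : {ffun 'I_d -> 'I_D} -> F) :
  (forall i, (i <= d)%N -> idealr_closed (P i) /\ prime_idealr_closed (P i)) ->
  (forall i, (i < d)%N -> [/\ {subset P i <= P i.+1}, f i \in P i.+1 & f i \notin P i]) ->
  \sum_e c e *: \prod_(i < d) f i ^+ e i \in P 0%N -> forall e, c e = 0.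
Proof.
move=> idP stP sumP e0; apply/eqP; apply: contraT => nz_c0.
(* [ag j] is agreement of the first [j] exponents, and [tl j] is the monomial with these exponents
   removed. *)
pose ag j (e e' : {ffun 'I_d -> 'I_D}) := [forall i : 'I_d, (i < j)%N ==> (e i == e' i)].
pose tl j (e : {ffun 'I_d -> 'I_D}) := \prod_(i < d | (j <= i)%N) f i ^+ e i.
have H j : (j <= d)%N -> exists2 e, c e != 0 & \sum_(e' | ag j e e') c e' *: tl j e' \in P j.
  elim: j => [|j IHj] lt_jd.
    exists e0 => //; rewrite (eq_bigl xpredT) // => e.
    by apply/forallP.
  have [e nz_c sumPj] := IHj (ltnW lt_jd).
  have [[idj pj] [idj1 pj1]] := (idP j (ltnW lt_jd), idP j.+1 lt_jd).
  have [sub fin fout] := stP j lt_jd.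
  pose oj := Ordinal lt_jd.
  have ag_e : ag j e e && (c e != 0).
    by rewrite nz_c andbT; apply/forallP => i; rewrite eqxx implybT.
  case: (@arg_minnP _ e (fun e' => ag j e e' && (c e' != 0))
    (fun e' => e' oj : nat) ag_e) => e1 /andP[ag1 nz_c1] min1.
  exists e1 => //.
  have agE e' : ag j e1 e' = ag j e e'.
    apply/forallP/forallP => h i; apply/implyP => ij; move/forallP: ag1 => /(_ i).
      by rewrite ij => /eqP ->; have := h i; rewrite ij.
    by rewrite ij => /eqP <-; have := h i; rewrite ij.
  set m := (e1 oj : nat) in min1.
  pose X := \sum_(e' | ag j e1 e') c e' *: (f j ^+ (e' oj - m) * tl j.+1 e').
  have idM a u : u \in P j.+1 -> a * u \in P j.+1.
    by move=> uP; case: idj1 => z _ h; rewrite -[a * u]addr0; apply: h.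
  have idD u v : u \in P j.+1 -> v \in P j.+1 -> u + v \in P j.+1.
    by move=> uP vP; case: idj1 => z _ h; rewrite -[u]mul1r; apply: h.
  (* The sum is [f j ^+ m * X] with [m] the least exponent of [f j] that occurs; [P j] is prime and
     does not contain [f j], so the power can be cancelled. *)
  have XP : X \in P j.
    have : f j ^+ m * X \in P j.
      suff -> : f j ^+ m * X = \sum_(e' | ag j e e') c e' *: tl j e' by [].
      rewrite /X mulr_sumr; apply: eq_big => [e'|e' ag_e']; first by rewrite agE.
      have [-> | nz_c'] := eqVneq (c e') 0; first by rewrite !scale0r mulr0.
      rewrite -scalerAr mulrA -exprD subnKC; last by apply: min1; rewrite -agE ag_e'.
      congr (_ *: _); rewrite /tl [RHS](bigD1 oj) //=; congr (_ * _).
      by apply: eq_bigl => i; rewrite ltn_neqAle andbC eq_sym -val_eqE.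
    elim: (m) => [|k IHk]; first by rewrite expr0 mul1r.
    by rewrite exprS -mulrA => /pj /orP[|//]; rewrite (negbTE fout).
  have := sub _ XP; rewrite /X (bigID (ag j.+1 e1)) /= => XP'.
  (* The terms with a larger exponent retain a factor [f j], which lies in [P j.+1]. *)
  have YP : \sum_(e' | ag j e1 e' && ~~ ag j.+1 e1 e')
      c e' *: (f j ^+ (e' oj - m) * tl j.+1 e') \in P j.+1.
    elim/big_rec: _ => [|e' u /andP[ag1' nag1'] uP]; first by case: idj1.
    apply: idD uP; rewrite scalerAr.
    have [-> | nz_c'] := eqVneq (c e') 0.
      by rewrite scale0r mulr0; case: idj1.
    have : (m < e' oj)%N.
      rewrite ltn_neqAle min1 -?agE ?ag1' // andbT.
      apply: contra nag1' => /eqP m_e'; apply/forallP => i; rewrite ltnS leq_eqVlt.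
      apply/implyP => /orP[/eqP ij|ij].
        by rewrite (_ : i = oj); [apply/eqP/val_inj|apply/val_inj].
      by move/forallP: ag1' => /(_ i); rewrite ij.
    rewrite -subn_gt0 => /prednK <-; rewrite exprSr mulrAC.
    exact: idM.
  have := idD _ _ XP' (idM (-1) _ YP); rewrite mulN1r addrK.
  suff <- : \sum_(e' | ag j e1 e' && ag j.+1 e1 e')
      c e' *: (f j ^+ (e' oj - m) * tl j.+1 e') =
    \sum_(e' | ag j.+1 e1 e') c e' *: tl j.+1 e' by [].
  apply: eq_big => [e'|e' /andP[_ ag']].
    apply: andb_idl => /forallP ag'; apply/forallP => i; apply/implyP => ij.
    by have := ag' i; rewrite ltnS ltnW.
  suff -> : e' oj = e1 oj by rewrite subnn expr0 mul1r.
  by move/forallP: ag' => /(_ oj); rewrite ltnSn => /eqP.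
have [e nz_c] := H d (leqnn d).
have [[P0 P1 Pl] _] := idP d (leqnn d).
rewrite (big_pred1 e) => [|e']; last first.
  apply/forallP/eqP => [h|-> i]; last by rewrite eqxx implybT.
  by apply/ffunP => i; have := h i; rewrite ltn_ord => /eqP.
(* All exponents are now fixed: a nonzero constant would lie in [P d], against properness. *)
rewrite /tl big1 => [|i]; last by rewrite leqNgt ltn_ord.
move=> cP; case/negP: P1.
have := Pl (mpolyC n (c e)^-1) _ _ cP P0.
by rewrite addr0 mul_mpolyC scalerA mulVf // scale1r.
Qed.

Lemma rmorph_mmap (R A B : comNzRingType) (f : {rmorphism R -> A}) (g : {rmorphism A -> B})
    n (h : 'I_n -> A) p :
  g (mmap f h p) = mmap (g \o f) (g \o h) p.
Proof.
rewrite /mmap rmorph_sum; apply: eq_bigr => m _ /=; rewrite rmorphM rmorph_prod.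
by congr (_ * _); apply: eq_bigr => i _; rewrite rmorphXn.
Qed.

Lemma eq_mmap (R A : comNzRingType) (f g : R -> A) n (h k : 'I_n -> A) p :
  f =1 g -> h =1 k -> mmap f h p = mmap g k p.
Proof.
move=> fg hk; apply: eq_bigr => m _; rewrite fg; congr (_ * _).
by apply: eq_bigr => i _; rewrite hk.
Qed.

Section Cone.
Variables (F : numFieldType) (K n : nat) (Psi : 'I_n -> mpoly K F).

Definition coord_sum := \sum_j Psi j.
Definition eval_row (t : 'rV[F]_K) : 'rV[F]_n := \row_j meval (t 0) (Psi j).
Definition jacobian (t : 'rV[F]_K) : 'M[F]_(K, n) :=
  \matrix_(l, j) meval (t 0) (mderiv l (Psi j)).
(* The dimension of the tangent space at Psi t of the cone over the image of Psi. *)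
Definition cone_rank t := \rank (col_mx (eval_row t) (jacobian t)).

Lemma dependent_of_cone_rank k d (t0 : 'rV[F]_K) (f : nat -> mpoly n F) :
  meval (t0 0) coord_sum != 0 -> cone_rank t0 = k.+1 ->
  (forall t, cone_rank t <= k.+1)%N -> (k < d)%N ->
  exists D, exists2 c : {ffun 'I_d -> 'I_D} -> F, exists e, c e != 0 &
    forall t : 'rV[F]_K, meval (t 0) coord_sum != 0 ->
      meval (fun j => meval (t 0) (Psi j) / meval (t 0) coord_sum)
        (\sum_e c e *: \prod_(i < d) f i ^+ e i) = 0.
Proof.
move=> nz0 rk0 rk_le lt_kd.
have [|V [W [yW VJW]]] := @dual_frame F K n k (eval_row t0) (jacobian t0).
  by rewrite -/(cone_rank t0) rk0.
(* [w0] completes [W] to a frame dual to [Psi t0] and the slice directions: the product is block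
   triangular with unit diagonal, so the determinant at [t0] is 1. *)
pose w0 : 'cV[F]_n := const_mx (meval (t0 0) coord_sum)^-1.
pose W' : 'M[F]_(n, 1 + k) := row_mx w0 W.
have yw0 : eval_row t0 *m w0 = 1%:M.
  apply/rowP => i; rewrite !mxE ord1 /=; under eq_bigr do rewrite !mxE.
  by rewrite -mulr_suml -raddf_sum divff.
have detMW : \det (col_mx (eval_row t0) (V *m jacobian t0) *m W') = 1.
  by rewrite mul_col_row yW VJW yw0 det_lblock !det1 mulr1.
(* [B] is the ring of functions on the slice [t0 + a *m V], and [A] adds a variable [tau] running
   from [t0] towards [t1]. [th0] and [th] are the pullbacks to the slice and to this larger
   family. *)
pose B := mpoly k F; pose A := {poly B}.
pose h0 (l : 'I_K) : B := mpolyC k (t0 0 l) + \sum_b V b l *: 'X_b.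
pose th0 : {rmorphism mpoly K F -> B} := mmap (@mpolyC k F) h0.
have [D [E [c [nzc szp p0]]]] :=
  homog_dep (th0 \o Psi) (th0 coord_sum) f lt_kd.
exists D, c => // t1 nz1; set p := \sum_e _ in szp p0 *.
pose e l : F := t1 0 l - t0 0 l.
pose f0 : {rmorphism F -> A} := polyC \o @mpolyC k F.
pose h (l : 'I_K) : A := (h0 l)%:P + f0 (e l) * 'X.
pose th : {rmorphism mpoly K F -> A} := mmap f0 h.
pose G := homog_eval E f0 (th \o Psi) (th coord_sum) p.
pose ev (a : 'rV[F]_k) (tau : F) : {rmorphism A -> F} :=
  horner_eval tau \o map_poly (meval (a 0)).
pose pt (a : 'rV[F]_k) tau : 'rV[F]_K := t0 + a *m V + tau *: (t1 - t0).
have evf a tau x : ev a tau (f0 x) = x.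
  by rewrite /= map_polyC /horner_eval hornerC [LHS]mevalC.
have evC a tau x : ev a tau x%:P = meval (a 0) x.
  by rewrite /= map_polyC /horner_eval hornerC.
have evX a tau : ev a tau 'X = tau by rewrite /= map_polyX /horner_eval hornerX.
have evh a tau l : ev a tau (h l) = pt a tau 0 l.
  transitivity (ev a tau (h0 l)%:P + ev a tau (f0 (e l)) * ev a tau 'X).
    by rewrite -(rmorphM (ev a tau)) -(rmorphD (ev a tau)).
  rewrite evf evX evC /h0 !mxE [e l * _]mulrC; congr (_ + _).
  rewrite [LHS]mevalD mevalC; congr (_ + _).
  rewrite raddf_sum; apply: eq_bigr => b _ /=.
  by rewrite [LHS]mevalZ mevalXU mulrC.
have evth a tau q : ev a tau (th q) = meval (pt a tau 0) q.
  by rewrite [th q]/(mmap f0 h q) rmorph_mmap; apply: eq_mmap; [exact: evf | exact: evh].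
(* Identities in [A] may be checked pointwise, where the rank hypothesis is available. *)
have evI x : (forall a tau, ev a tau x = 0) -> x = 0.
  move=> x0; apply/polyP => i; rewrite coef0; apply: mpoly_eq0_of_pos => v _.
  pose a := \row_j v j : 'rV[F]_k.
  have -> : meval v x`_i = (map_poly (meval (a 0)) x)`_i.
    by rewrite coef_map; apply: meval_eq => j; rewrite mxE.
  by rewrite [map_poly _ x]poly_eq0_of_pos ?coef0 // => tau _; apply: x0.
pose Dt (b : 'I_k) : A -> A := map_poly (mderiv b).
have dD : is_derivation f0 (@deriv B).
  by split=> [p1 q1|p1 q1|x]; rewrite ?derivD ?derivM ?derivC.
have dDt b : is_derivation f0 (Dt b).
  split=> [p1 q1|p1 q1|x]; first exact: raddfD.
    apply/polyP => i; rewrite coef_map /= coefD !coefM raddf_sum -big_split.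
    by apply: eq_bigr => j _; rewrite !coef_map /= mderivM.
  by rewrite /Dt /= map_polyC /= mderivC.
have Dth q : (th q)^`() = \sum_l th (mderiv l q) * f0 (e l).
  have [DD DM Df] := dD; rewrite [LHS](derivation_mmap _ DD DM Df).
  apply: eq_bigr => l _; congr (_ * _).
  by rewrite /h derivD derivC add0r derivM derivX mulr1 derivC mul0r add0r.
have Dtth b q : Dt b (th q) = \sum_l th (mderiv l q) * f0 (V b l).
  have [DD DM Df] := dDt b; rewrite [LHS](derivation_mmap _ DD DM Df).
  apply: eq_bigr => l _; congr (_ * _).
  have DX : Dt b 'X = 0.
    apply/polyP => i; rewrite coef_map coefX coef0 -[(_ == _)%:R]mpolyC_nat.
    exact: mderivC.
  rewrite /h DD DM Df mul0r add0r DX mulr0 addr0 /Dt map_polyC /=; congr _%:P.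
  rewrite mderivD mderivC add0r linear_sum (bigD1 b) //= big1 => [|b' b'b].
    rewrite addr0 mderivZ mderivX mnmE eqxx scale1r -{1}[mnm1 b]add0m addmK.
    by rewrite mpolyX0 -mul_mpolyC mulr1.
  by rewrite mderivZ mderivX mnmE (negbTE b'b) scale0r scaler0.
(* [M] holds the point and its slice derivatives, [r] the derivative in [tau], all over [A]; [Delta]
   is the common denominator in Cramer's rule. *)
pose M : 'M[A]_(1 + k, n) :=
  col_mx (\row_j th (Psi j)) (\matrix_(b, j) Dt b (th (Psi j))).
pose r : 'rV[A]_n := \row_j (th (Psi j))^`().
pose w : 'M[A]_(n, 1 + k) := map_mx f0 W'.
pose b := r *m w *m \adj (M *m w).
pose Delta := \det (M *m w).
have evM a tau : map_mx (ev a tau) M =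
    col_mx (eval_row (pt a tau)) (V *m jacobian (pt a tau)).
  rewrite map_col_mx; congr col_mx; apply/matrixP => i j; rewrite !mxE.
    exact: evth.
  rewrite Dtth rmorph_sum; apply: eq_bigr => l _; rewrite rmorphM evth.
  by rewrite !mxE mulrC evf.
have evr a tau : map_mx (ev a tau) r = (t1 - t0) *m jacobian (pt a tau).
  apply/matrixP => i j; rewrite !mxE Dth rmorph_sum; apply: eq_bigr => l _.
  by rewrite rmorphM evth !mxE mulrC evf ord1.
have evw a tau : map_mx (ev a tau) w = W'.
  by apply/matrixP => i j; rewrite !mxE evf.
have Delta0 : Delta`_0 != 0.
  apply/negP => /eqP D0.
  have : ev 0 0 Delta = 0 by rewrite /= /horner_eval horner_coef0 coef_map D0 [LHS]meval0.
  rewrite -det_map_mx map_mxM evM evw.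
  rewrite /pt mul0mx scale0r !addr0 detMW => /eqP; rewrite oner_eq0 //.
(* Maximality of the rank enters here: no value of [cone_rank] exceeds the number [k.+1] of rows of
   [M]. *)
have DrE : Delta *: r = b *m M.
  have nzD : Delta != 0 by apply: contraNneq Delta0 => ->; rewrite coef0.
  apply/eqP; rewrite -subr_eq0; apply/eqP/rowP => j; rewrite [RHS]mxE.
  apply: (mulfI nzD); rewrite mulr0; apply: evI => a tau.
  pose Q := col_mx (eval_row (pt a tau)) (jacobian (pt a tau)).
  have MQ : (map_mx (ev a tau) M <= Q)%MS.
    by rewrite evM -!addsmxE addsmxS // submxMl.
  have rQ : (map_mx (ev a tau) r <= Q)%MS.
    by rewrite evr -addsmxE; apply: submx_trans (submxMl _ _) (addsmxSr _ _).
  have := @cramer_row _ _ _ _ _ _ _ (map_mx (ev a tau) w) MQ rQ (rk_le _).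
  move=> X0; have {X0} : map_mx (ev a tau) (Delta *: (Delta *: r - b *m M)) = 0.
    by rewrite !(map_mxZ, map_mxB, map_mxM, map_mx_adj) -det_map_mx map_mxM; exact: X0.
  by move/matrixP/(_ 0 j); rewrite !mxE.
have DthE j : Delta * (th (Psi j))^`() = b 0 0 * th (Psi j) +
    \sum_i b 0 (rshift 1 i) * Dt i (th (Psi j)).
  have := congr1 (fun m : 'rV[A]_n => m 0 j) DrE.
  rewrite !mxE => ->; rewrite big_split_ord big_ord1; congr (_ + _).
    by rewrite col_mxEu !mxE (_ : lshift k ord0 = 0) //; apply: val_inj.
  by apply: eq_bigr => i _; rewrite col_mxEd !mxE.
have thT : th coord_sum = \sum_j th (Psi j) by exact: raddf_sum.
have DthTE : Delta * (th coord_sum)^`() = b 0 0 * th coord_sum +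
    \sum_i b 0 (rshift 1 i) * Dt i (th coord_sum).
  rewrite thT [(\sum_j _)^`()]raddf_sum mulr_sumr (eq_bigr _ (fun j _ => DthE j)).
  rewrite big_split -mulr_sumr exchange_big; congr (_ + _).
  by apply: eq_bigr => i _; rewrite [Dt i _]raddf_sum -mulr_sumr.
(* At [tau = 0] the pullback [th] becomes [th0], so this is the relation found on the slice. *)
have G0 : G`_0 = 0.
  have th0E q : (th q)`_0 = th0 q.
    rewrite -horner_coef0 -[_.[0]]/(horner_eval 0 (mmap f0 h q)) rmorph_mmap.
    apply: eq_mmap => [x|l] /=; first by rewrite /horner_eval hornerC.
    by rewrite /horner_eval /h !hornerE.
  rewrite -horner_coef0 -[_.[0]]/(horner_eval 0 G) rmorph_homog_eval -[RHS]p0.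
  apply: eq_homog_eval => [x|j|] /=.
  - by rewrite /horner_eval hornerC.
  - by rewrite /horner_eval horner_coef0 th0E.
  - by rewrite /horner_eval horner_coef0 th0E.
have {}G0 : G = 0.
  have charB i : i.+1%:R != 0 :> B by rewrite -mpolyC_nat mpolyC_eq0 pnatr_eq0.
  apply: (poly_eq0_of_diff_eq (D := fun i => mderiv i) charB _ Delta0 G0).
    by move=> i; rewrite mderiv0.
  exact: derivation_homog_eval dD dDt DthE DthTE.
(* The point [a = 0], [tau = 1] of the family is the arbitrary [t1]. *)
have : ev 0 1 G = 0 by rewrite G0 rmorph0.
have pt1 : pt 0 1 = t1 by rewrite /pt mul0mx addr0 scale1r addrC subrK.
rewrite rmorph_homog_eval (@eq_homog_eval _ _ _ _ _ idfun _ (fun j => meval (t1 0) (Psi j))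
  _ (meval (t1 0) coord_sum)) => [|x|j|].
- rewrite homog_evalE // => /eqP; rewrite mulf_eq0 expf_eq0 (negbTE nz1) andbF.
  by move/eqP.
- exact: evf.
- by rewrite [LHS]evth pt1.
- by rewrite [LHS]evth pt1.
Qed.
End Cone.

(** * Chains of vanishing ideals of slices *)

(** The curves [z / s] pass through the origin in every direction. Along them the lowest form [Q] of
    the polynomial gives the leading coefficient, so [Q] vanishes at every positive [beta], which
    contradicts its choice. *)
Lemma curve_free (F : numFieldType) m D (c : {ffun 'I_m -> 'I_D} -> F) :
  (forall beta : 'I_m -> F, exists s : {poly F}, exists z : 'I_m -> {poly F},
    [/\ s`_0 != 0, forall b, (z b)`_0 = 0, forall b, (z b)`_1 = beta b
      & forall x, s.[x] != 0 -> \sum_e c e * \prod_b ((z b).[x] / s.[x]) ^+ e b = 0]) ->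
  forall e, c e = 0.
Proof.
move=> hc e0; apply/eqP; apply: contraT => nz_c0.
pose deg (e : {ffun 'I_m -> 'I_D}) := (\sum_b e b)%N.
case: (@arg_minnP _ e0 (fun e => c e != 0) deg nz_c0) => e1 nz_c1 min1.
pose Q := \sum_(e : {ffun 'I_m -> 'I_D} | deg e == deg e1)
  c e *: mpolyX F (Multinom [tuple (e b : nat) | b < m]).
suff Q0 : Q = 0.
  have := congr1 (mcoeff (Multinom [tuple (e1 b : nat) | b < m])) Q0.
  rewrite mcoeff0 linear_sum (bigD1 e1) //= big1 => [|e /andP[_ ne]].
    by rewrite addr0 linearZ /= mcoeffX eqxx mulr1 => /eqP; rewrite (negbTE nz_c1).
  rewrite linearZ /= mcoeffX (_ : _ == _ = false) ?mulr0 //.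
  apply: contraNF ne => /eqP ee1; apply/eqP/ffunP => b; apply: val_inj.
  by have := congr1 (fun m' : multinom m => m' b) ee1; rewrite !mnmE.
apply: mpoly_eq0_of_pos => beta _.
have [s [z [nz_s z0 z1 H0]]] := hc beta.
pose z' b := drop_poly 1 (z b).
have zE b : z b = z' b * 'X.
  rewrite -[LHS](poly_take_drop 1) expr1 [take_poly _ _](_ : _ = 0) ?add0r //.
  by apply/polyP => -[|i]; rewrite coef_take_poly ?z0 ?coef0.
have z'0 b : (z' b).[0] = beta b by rewrite horner_coef0 coef_drop_poly addn1 z1.
pose M := (\sum_(b < m) D)%N.
have deg_le e : (deg e <= M)%N by apply: leq_sum => b _; apply: ltnW.
(* The relation multiplied by [s ^+ M] and divided by ['X^(deg e1)]. The truncated [deg e - deg e1]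
   is harmless: [c e = 0] whenever [deg e < deg e1]. *)
pose H := \sum_e c e *: (s ^+ (M - deg e) * 'X^(deg e - deg e1) * \prod_b z' b ^+ e b).
have H_0 : H = 0.
  (* The extra factor [s] takes care of the points where [s] vanishes. *)
  have nz : 'X^(deg e1) * s != 0 :> {poly F}.
    rewrite mulf_neq0 ?expf_neq0 ?polyX_eq0 //.
    by apply: contraNneq nz_s => ->; rewrite coef0.
  apply: (mulfI nz); rewrite mulr0; apply: poly_eq0_of_pos => x _.
  have [sx0|nz_sx] := eqVneq s.[x] 0; first by rewrite !hornerM sx0 mulr0 mul0r.
  rewrite -mulrA mulrCA hornerM.
  suff -> : ('X^(deg e1) * H).[x] = s.[x] ^+ M * \sum_e c e * \prod_b ((z b).[x] / s.[x]) ^+ e b.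
    by rewrite H0 // !mulr0.
  rewrite hornerM horner_sum !mulr_sumr; apply: eq_bigr => e _.
  have [->|nz_c] := eqVneq (c e) 0; first by rewrite scale0r horner0 mul0r !mulr0.
  rewrite hornerZ mulrCA [RHS]mulrCA; congr (_ * _).
  have -> : \prod_b ((z b).[x] / s.[x]) ^+ e b = \prod_b (z b).[x] ^+ e b / s.[x] ^+ deg e.
    under eq_bigr do rewrite expr_div_n.
    by rewrite prodf_div prodrXr.
  rewrite -[in RHS](subnK (deg_le e)) exprD -[RHS]mulrA.
  rewrite [X in _ = _ * X]mulrC divfK ?expf_neq0 //.
  rewrite !hornerM !hornerXn !horner_exp -!mulrA mulrCA; congr (_ * _).
  rewrite mulrA -exprD subnKC; last exact: min1.
  rewrite horner_prod -prodrXr -big_split; apply: eq_bigr => b _ /=.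
  by rewrite zE horner_exp hornerM hornerX exprMn mulrC.
have : (s`_0) ^+ (M - deg e1) * meval beta Q = 0.
  rewrite -[RHS](horner0 0) -H_0 /Q raddf_sum mulr_sumr horner_sum.
  rewrite [RHS](bigID (fun e => deg e == deg e1)) /= [X in _ = _ + X]big1 => [|e ne].
    rewrite addr0; apply: eq_bigr => e /eqP de.
    rewrite hornerZ !hornerM horner_exp -horner_coef0 de subnn expr0 hornerC mulr1.
    rewrite mevalZ mevalX mulrCA horner_prod; do 2 congr (_ * _).
    by apply: eq_bigr => b _; rewrite horner_exp z'0 mnmE.
  have [->|nz_c] := eqVneq (c e) 0; first by rewrite scale0r horner0.
  rewrite hornerZ !hornerM hornerXn expr0n subn_eq0 leqNgt ltn_neqAle eq_sym ne min1 //.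
  by rewrite mulr0 mul0r mulr0.
by move/eqP; rewrite mulf_eq0 expf_eq0 (negbTE nz_s) andbF => /eqP.
Qed.

Section SliceChain.
Variables (F : numFieldType) (K n : nat) (Psi : 'I_n -> mpoly K F) (t0 : 'rV[F]_K).

Local Notation tot := (coord_sum Psi).

Definition param (t : 'rV[F]_K) (j : 'I_n) : F := meval (t 0) (Psi j) / meval (t 0) tot.

Definition line_restr (t v : 'rV[F]_K) : {rmorphism mpoly K F -> {poly F}} :=
  mmap (@polyC F) (fun l => (t 0 l)%:P + (v 0 l)%:P * 'X).

Lemma horner_line t v p x : (line_restr t v p).[x] = meval ((t + x *: v) 0) p.
Proof.
rewrite -[LHS]/(horner_eval x (mmap _ _ p)) rmorph_mmap; apply: eq_mmap => [c|l] /=.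
  by rewrite /horner_eval hornerC.
by rewrite /horner_eval !hornerE !mxE mulrC.
Qed.

Lemma coef1_line t v p : (line_restr t v p)`_1 = \sum_l v 0 l * meval (t 0) (mderiv l p).
Proof.
have -> : (line_restr t v p)`_1 = (line_restr t v p)^`().[0] by rewrite horner_coef0 coef_deriv.
rewrite (derivation_mmap (f := @polyC F) _ (@derivD _) (@derivM _) (@derivC _)) horner_sum.
apply: eq_bigr => l _; rewrite hornerM -/(line_restr t v _) horner_line scale0r addr0 mulrC.
by rewrite derivD derivM derivX !derivC !hornerE.
Qed.

Definition slice_ideal k (V : 'M[F]_(k, K)) : {pred mpoly n F} :=
  [pred f | `[< forall a : 'rV[F]_k, meval ((t0 + a *m V) 0) tot != 0 ->
                 meval (param (t0 + a *m V)) f = 0 >]].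

Lemma slice_idealP k (V : 'M[F]_(k, K)) f :
  f \in slice_ideal V <-> forall a : 'rV[F]_k, meval ((t0 + a *m V) 0) tot != 0 ->
    meval (param (t0 + a *m V)) f = 0.
Proof. by split=> [/asboolW//|h]; apply: asboolT. Qed.

Hypothesis nz0 : meval (t0 0) tot != 0.

Lemma slice_idealr_closed k (V : 'M[F]_(k, K)) : idealr_closed (slice_ideal V).
Proof.
split.
- by apply/slice_idealP => a _; rewrite meval0.
- apply/negP => /slice_idealP/(_ 0); rewrite mul0mx addr0 => /(_ nz0)/eqP.
  by rewrite meval1 oner_eq0.
move=> f u v /slice_idealP hu /slice_idealP hv; apply/slice_idealP => a nz.
by rewrite mevalD mevalM hu // hv // mulr0 addr0.
Qed.

(** If [u] is nonzero at [a1] and [v] at [a2], restrict to the line through both points: the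
    pullbacks are univariate polynomials with product zero, yet neither is zero. *)
Lemma slice_prime k (V : 'M[F]_(k, K)) : prime_idealr_closed (slice_ideal V).
Proof.
move=> u v /slice_idealP huv; apply/orP.
have [//|/existsNP[a1 /not_implyP[nz1 /eqP u1]]] :=
  pselect (forall a : 'rV[F]_k, meval ((t0 + a *m V) 0) tot != 0 ->
                 meval (param (t0 + a *m V)) u = 0); first by left; apply/slice_idealP.
right; apply/slice_idealP => a2 nz2; apply/eqP; apply: contraT => v2.
pose ln := line_restr (t0 + a1 *m V) ((a2 - a1) *m V).
have lnE p x : (ln p).[x] = meval ((t0 + (a1 + x *: (a2 - a1)) *m V) 0) p.
  by rewrite horner_line [in RHS]mulmxDl -scalemxAl addrA.
pose H (f : mpoly n F) := homog_eval (msize f) (@polyC F) (ln \o Psi) (ln tot) f.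
have HE f x : (ln tot).[x] != 0 ->
    (H f).[x] = (ln tot).[x] ^+ msize f * meval (param (t0 + (a1 + x *: (a2 - a1)) *m V)) f.
  move=> nz; rewrite -[LHS]/(horner_eval x (H f)) rmorph_homog_eval.
  rewrite (@eq_homog_eval _ _ _ _ _ idfun _ (fun j => (ln (Psi j)).[x]) _ (ln tot).[x]) //.
    rewrite homog_evalE //; congr (_ * _); apply: meval_eq => j.
    by rewrite /param !lnE.
  by move=> c; rewrite /= /horner_eval hornerC.
(* The factor [ln tot] covers the points of the line where [param] has a zero denominator. *)
have : H u * H v * ln tot = 0.
  apply: poly_eq0_of_pos => x _; rewrite !hornerM.
  have [->|nz] := eqVneq (ln tot).[x] 0; first by rewrite mulr0.
  rewrite !HE // mulrACA -mevalM huv ?mulr0 ?mul0r //.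
  by rewrite -lnE.
have ln0 : (ln tot).[0] != 0 by rewrite lnE scale0r addr0.
have ln1 : (ln tot).[1] != 0 by rewrite lnE scale1r (addrC a1) subrK.
move/eqP; rewrite !mulf_eq0 => /orP[/orP[]|] /eqP h0.
- have /eqP := HE u 0 ln0; rewrite h0 horner0 scale0r addr0 eq_sym mulf_eq0.
  by rewrite expf_eq0 (negbTE ln0) andbF (negbTE u1).
- have /eqP := HE v 1 ln1; rewrite h0 horner0 scale1r (addrC a1) subrK eq_sym mulf_eq0.
  by rewrite expf_eq0 (negbTE ln1) andbF (negbTE v2).
- by move: ln0; rewrite h0 horner0 eqxx.
Qed.

Definition slice_morph k (V : 'M[F]_(k, K)) : {rmorphism mpoly K F -> mpoly k F} :=
  mmap (@mpolyC k F) (fun l => mpolyC k (t0 0 l) + \sum_b V b l *: 'X_b).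

Lemma meval_slice k (V : 'M[F]_(k, K)) (a : 'rV[F]_k) p :
  meval (a 0) (slice_morph V p) = meval ((t0 + a *m V) 0) p.
Proof.
rewrite [LHS](rmorph_mmap _ (meval (a 0))); apply: eq_mmap => [c|l] /=; first exact: mevalC.
rewrite mevalD mevalC !mxE; congr (_ + _); rewrite raddf_sum; apply: eq_bigr => b _ /=.
by rewrite mevalZ mevalXU mulrC.
Qed.

Definition first_rows (v : nat -> 'rV[F]_K) k : 'M[F]_(k, K) := \matrix_(b < k) v b.

Lemma slice_ideal_mono v k :
  {subset slice_ideal (first_rows v k.+1) <= slice_ideal (first_rows v k)}.
Proof.
move=> f /slice_idealP hf; apply/slice_idealP => a.
suff -> : a *m first_rows v k =
  (\row_(b < k.+1) (if unlift ord_max b is Some b' then a 0 b' else 0)) *m first_rows v k.+1.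
  exact: hf.
apply/rowP => l; rewrite !mxE [RHS]big_ord_recr /= !mxE unlift_none mul0r addr0.
apply: eq_bigr => b _; rewrite !mxE.
have -> : widen_ord (leqnSn k) b = lift ord_max b.
  by apply: val_inj; apply: esym (lift_max b).
by rewrite liftK lift_max.
Qed.

(** On the [k]-dimensional slice the [k.+1] linear forms given by [W] are algebraically dependent by
    counting. On the larger slice, lines through [t0] give them every tangent direction, so
    [curve_free] excludes the relation. *)
Lemma slice_ideal_strict v k (W : 'M[F]_(n, k.+1)) :
  eval_row Psi t0 *m W = 0 ->
  first_rows v k.+1 *m jacobian Psi t0 *m W = 1%:M ->
  exists2 f, f \in slice_ideal (first_rows v k) & f \notin slice_ideal (first_rows v k.+1).
Proof.
move=> yW VJW; set V := first_rows v k; set V1 := first_rows v k.+1 in VJW *.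
pose lf m := if insub m is Some b then \sum_j W j b *: 'X_j else 0 : mpoly n F.
have lfE (b : 'I_k.+1) : lf b = \sum_j W j b *: 'X_j by rewrite /lf valK.
have [D [E [c [[e nzc] szp p0]]]] :=
  homog_dep (slice_morph V \o Psi) (slice_morph V tot) lf (ltnSn k).
set p := \sum_e _ in szp p0; exists p.
  apply/slice_idealP => a nz.
  have := congr1 (meval (a 0)) p0; rewrite meval0 rmorph_homog_eval.
  rewrite (@eq_homog_eval _ _ _ _ _ idfun _ (fun j => meval ((t0 + a *m V) 0) (Psi j))
    _ (meval ((t0 + a *m V) 0) tot)) => [|x|j|].
  - rewrite homog_evalE // => /eqP; rewrite mulf_eq0 expf_eq0 (negbTE nz) andbF.
    by move/eqP.
  - exact: mevalC.
  - exact: meval_slice.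
  - exact: meval_slice.
apply/negP => /slice_idealP p_van.
have : c e = 0; last by apply/eqP.
apply: curve_free => beta; pose a := \row_b beta b.
pose ln := line_restr t0 (a *m V1).
have ln0 q : (ln q)`_0 = meval (t0 0) q.
  by rewrite -horner_coef0 horner_line scale0r addr0.
exists (ln tot), (fun b => \sum_j W j b *: ln (Psi j)); split=> [|b|b|x nz].
- by rewrite ln0.
- rewrite coef_sum; under eq_bigr do rewrite coefZ ln0.
  have := congr1 (fun m : 'rV[F]_k.+1 => m 0 b) yW; rewrite !mxE => h; rewrite -[RHS]h.
  by apply: eq_bigr => j _; rewrite mxE mulrC.
- rewrite coef_sum; under eq_bigr do rewrite coefZ coef1_line.
  have : (a *m V1 *m jacobian Psi t0 *m W) 0 b = beta b.
    by rewrite -!mulmxA (mulmxA V1) VJW mulmx1 mxE.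
  rewrite mxE => h; rewrite -[RHS]h; apply: eq_bigr => j _.
  rewrite mulrC !mxE; congr (_ * _); apply: eq_bigr => l _.
  by rewrite [jacobian _ _ _ _]mxE.
have nz' : meval ((t0 + (x *: a) *m V1) 0) tot != 0.
  by rewrite -scalemxAl -horner_line.
have := p_van _ nz'; rewrite /p raddf_sum => h; rewrite -[RHS]h.
apply: eq_bigr => e' _ /=; rewrite mevalZ rmorph_prod; congr (_ * _).
apply: eq_bigr => b _; rewrite rmorphXn /= lfE; congr (_ ^+ _).
rewrite [RHS]raddf_sum horner_sum mulr_suml; apply: eq_bigr => j _ /=.
by rewrite mevalZ mevalXU hornerZ -mulrA /param !horner_line -scalemxAl.
Qed.

Lemma slice_chain d : (d < cone_rank Psi t0)%N ->
  exists P : nat -> {pred mpoly n F},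
  [/\ forall i, idealr_closed (P i) /\ prime_idealr_closed (P i),
      forall i f, (forall t : 'rV[F]_K, meval (t 0) tot != 0 -> meval (param t) f = 0) -> f \in P i
    & forall i, (i < d)%N -> {subset P i <= P i.+1} /\
        exists2 f, f \in P i.+1 & f \notin P i].
Proof.
case/dual_frame => V [W [yW VJW]].
pose v b := if insub b is Some b' then row b' V else 0.
(* Dropping a direction shrinks the slice and enlarges its ideal, so the ideals are indexed by
   [d - i]. *)
exists (fun i => slice_ideal (first_rows v (d - i))); split=> [i|i f hf|i lt_id].
- by split; [exact: slice_idealr_closed | exact: slice_prime].
- by apply/slice_idealP => a; apply: hf.
rewrite -(subnSK lt_id); set k := (d - i.+1)%N.
have le_kd : (k.+1 <= d)%N by rewrite /k subnSK // leq_subr.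
split; first exact: slice_ideal_mono.
apply: (@slice_ideal_strict v k (colsub (widen_ord le_kd) W)).
  by rewrite mulmx_colsub yW; apply/matrixP => ? ?; rewrite !mxE.
have -> : first_rows v k.+1 = rowsub (widen_ord le_kd) V.
  apply/matrixP => b l; rewrite !mxE /v insubT ?(leq_trans (ltn_ord b)) // => h.
  by rewrite mxE; congr (V _ _); apply: val_inj.
rewrite mulmx_colsub !mul_rowsub_mx VJW.
by apply/matrixP => x y; rewrite !mxE -!val_eqE.
Qed.

End SliceChain.

(** * Tangent spaces of the two models *)

(** Semicontinuity of the rank: a compressed determinant that is nonzero at [t0] is a nonzero
    polynomial, hence nonzero at some positive point. *)
Lemma rank_pos_point (F : numFieldType) K m n (M : 'M[mpoly K F]_(m, n)) (t0 : 'rV[F]_K) :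
  exists2 t : 'rV[F]_K, forall l, 0 < t 0 l &
    (\rank (map_mx (meval (t0 0%R)) M) <= \rank (map_mx (meval (t 0%R)) M))%N.
Proof.
set d := \rank _; have [V [W VMW]] := rank_frame (leqnn d).
pose p := \det (map_mx (@mpolyC K F) V *m M *m map_mx (@mpolyC K F) W).
have pE v : meval v p = \det (V *m map_mx (meval v) M *m W).
  rewrite -[LHS]det_map_mx !map_mxM; congr (\det (_ *m _ *m _));
  by apply/matrixP => i j; rewrite !mxE [LHS]mevalC.
have [t t_gt0 pt] : exists2 v, (forall l, 0 < v l) & meval v p != 0.
  apply: contrapT => nex; suff p0 : p = 0.
    by have := pE (t0 0); rewrite p0 meval0 VMW det1 => /esym/eqP; rewrite oner_eq0.
  apply: mpoly_eq0_of_pos => v v_gt0; apply/eqP; apply: contrapT => /negP nz.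
  by apply: nex; exists v.
exists (\row_l t l) => [l|]; first by rewrite mxE.
have tE : (fun l => (\row_l t l) 0 l) =1 t by move=> l; rewrite mxE.
have := pt; rewrite -(meval_eq _ tE) pE -unitfE -unitmxE => /mxrank_unit {1}<-.
exact: leq_trans (mxrankM_maxl _ _) (mxrankM_maxr _ _).
Qed.

Lemma cone_rank_le_pos (F : numFieldType) K n (Psi : 'I_n -> mpoly K F) t0 :
  exists2 t : 'rV[F]_K, forall l, 0 < t 0 l & (cone_rank Psi t0 <= cone_rank Psi t)%N.
Proof.
pose M : 'M[mpoly K F]_(1 + K, n) := col_mx (\row_j Psi j) (\matrix_(l, j) mderiv l (Psi j)).
have ME (t : 'rV[F]_K) : map_mx (meval (t 0)) M = col_mx (eval_row Psi t) (jacobian Psi t).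
  by rewrite map_col_mx; congr col_mx; apply/matrixP => i j; rewrite !mxE.
by have [t t_gt0] := rank_pos_point M t0; rewrite !ME; exists t.
Qed.

Section MonomialModels.
Variables (F : numFieldType) (I : finType) (n N : nat) (alpha : 'I_n -> 'I_N -> nat).

(* (i, None) is the weight of the i-th point, (i, Some l) its l-th coordinate. *)
Definition var_index : finType := (I * option 'I_n)%type.
Local Notation K := #|var_index|.

Definition mvar (c : var_index) : mpoly K F := 'X_(enum_rank c).
Definition mono (i : I) (j : 'I_N) := \prod_l mvar (i, Some l) ^+ alpha l j.
Definition wmono i j := mvar (i, None) * mono i j.
Definition value (t : 'rV[F]_K) (c : var_index) := t 0 (enum_rank c).

Lemma meval_mono (t : 'rV[F]_K) i j :
  meval (t 0) (mono i j) = \prod_l value t (i, Some l) ^+ alpha l j.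
Proof. by rewrite rmorph_prod; apply: eq_bigr => l _; rewrite rmorphXn /= mevalXU. Qed.

Lemma meval_wmono (t : 'rV[F]_K) i j :
  meval (t 0) (wmono i j) = value t (i, None) * \prod_l value t (i, Some l) ^+ alpha l j.
Proof. by rewrite mevalM mevalXU meval_mono. Qed.

Lemma mderiv_var c c' : mderiv (enum_rank c) (mvar c') = (c == c')%:R.
Proof.
rewrite mderivX mnmE eq_sym (inj_eq enum_rank_inj); case: eqP => [->|_].
  by rewrite scale1r -{1}[mnm1 _]add0m addmK mpolyX0.
by rewrite scale0r.
Qed.

(** Logarithmic derivations: monomials are eigenvectors, with the exponent as eigenvalue. *)
Definition euler (c : var_index) (q : mpoly K F) := mvar c * mderiv (enum_rank c) q.

Lemma eulerD c : {morph euler c : p q / p + q}.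
Proof. by move=> p q; rewrite /euler mderivD mulrDr. Qed.

Lemma eulerM c p q : euler c (p * q) = euler c p * q + p * euler c q.
Proof. by rewrite /euler mderivM mulrDr; congr (_ + _); [exact: mulrA | exact: mulrCA]. Qed.

Lemma eulerC c x : euler c (mpolyC K x) = 0.
Proof. by rewrite /euler mderivC mulr0. Qed.

Lemma euler_var c c' : euler c (mvar c') = mvar c' *+ (c == c').
Proof. by rewrite /euler mderiv_var mulr_natr; case: eqP => [->|_]; rewrite ?mulr0n. Qed.

Lemma euler_mono i c i' j :
  euler (i, c) (mono i' j) =
  mono i' j *+ (if c is Some l then (i == i') * alpha l j else 0).
Proof.
have EM a b p q : euler (i, c) p = p *+ a -> euler (i, c) q = q *+ b ->
    euler (i, c) (p * q) = (p * q) *+ (a + b).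
  by rewrite eulerM => -> ->; rewrite mulrnAl mulrnAr mulrnDr.
have E1 : euler (i, c) 1 = 1 *+ 0 by rewrite -(mpolyC1 K) eulerC.
pose w l := (((i, c) == (i', Some l)) * alpha l j)%N.
have -> : euler (i, c) (mono i' j) = mono i' j *+ (\sum_l w l).
  apply: (big_ind2 (fun p a => euler (i, c) p = p *+ a)) => // [p a q b|l _].
    exact: EM.
  rewrite /w mulnC; elim: (alpha l j) => [|k IHk]; first by rewrite expr0.
  by rewrite exprS mulSn; apply: EM => //; apply: euler_var.
congr (_ *+ _); rewrite /w; case: (c) => [l'|]; last first.
  by rewrite big1 // => l _; rewrite xpair_eqE andbF.
rewrite (bigD1 l') //= big1 => [|l /negbTE ll']; last first.
  by rewrite xpair_eqE (_ : Some l' == Some l = (l == l')) ?ll' ?andbF // eq_sym.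
by rewrite xpair_eqE eqxx andbT addn0.
Qed.

(** Characteristic of polynomials in the [wmono i' j] for fixed [j]: the weight and coordinates of
    the point [i] enter only through one weighted monomial. *)
Definition balanced i j q :=
  forall l, euler (i, Some l) q = euler (i, None) q *+ alpha l j.

Lemma balancedC i j x : balanced i j (mpolyC K x).
Proof. by move=> l; rewrite !eulerC mul0rn. Qed.

Lemma balancedD i j p q : balanced i j p -> balanced i j q -> balanced i j (p + q).
Proof. by move=> hp hq l; rewrite !eulerD hp hq mulrnDl. Qed.

Lemma balancedM i j p q : balanced i j p -> balanced i j q -> balanced i j (p * q).
Proof. by move=> hp hq l; rewrite !eulerM hp hq mulrnDl mulrnAl mulrnAr. Qed.

Lemma balanced_wmono i i' j : balanced i j (wmono i' j).
Proof.
move=> l; rewrite /wmono !eulerM !euler_var !euler_mono mulr0n mulr0 addr0.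
rewrite !xpair_eqE andbF andbT mulr0n mul0r add0r mulrnAr mulrnAl -mulrnA.
by case: (i == i').
Qed.

(** The monomial vectors of the points and their Euler derivatives. The weights are left out, so the
    matrix depends only on the coordinates. *)
Definition tangent (t : 'rV[F]_K) : 'M[F]_(K, N) :=
  \matrix_(l, j) (let c := enum_val l in
    (if c.2 is Some l' then (alpha l' j)%:R else 1) * meval (t 0) (mono c.1 j)).

Definition mixture_map (j : 'I_N) : mpoly K F := \sum_i wmono i j.

Lemma mderiv_wmono i i' j :
  mderiv (enum_rank ((i, None) : var_index)) (wmono i' j) = mono i' j *+ (i == i').
Proof.
have nz : mvar (i, None) != 0.
  apply/eqP => /(congr1 (meval (fun=> 1))); rewrite mevalXU meval0 => /eqP.
  by rewrite oner_eq0.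
apply: (mulfI nz); rewrite -[LHS]/(euler (i, None) (wmono i' j)) /wmono eulerM.
rewrite euler_var euler_mono mulr0n mulr0 addr0 xpair_eqE andbT.
by case: eqP => [->|_]; rewrite ?mulr0n ?mulr1n ?mul0r ?mulr0.
Qed.

Lemma balanced_meval (t : 'rV[F]_K) i l j q : balanced i j q ->
  value t (i, Some l) * meval (t 0) (mderiv (enum_rank ((i, Some l) : var_index)) q) =
  value t (i, None) * meval (t 0) (mderiv (enum_rank ((i, None) : var_index)) q)
    * (alpha l j)%:R.
Proof.
move=> /(_ l) /(congr1 (meval (t 0))); rewrite /euler mevalMn !mevalM !mevalXU => h.
by rewrite mulr_natr -[RHS]h.
Qed.

(** The vector itself is a combination of the weight rows, and each coordinate row of the Jacobian
    is a row of [tangent] rescaled by weight over coordinate. *)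
Lemma cone_rank_mixture_map (t : 'rV[F]_K) : (forall l, 0 < t 0 l) ->
  (cone_rank mixture_map t <= \rank (tangent t))%N.
Proof.
move=> t_gt0; apply: mxrankS; rewrite -addsmxE addsmx_sub; apply/andP; split.
  have -> : eval_row mixture_map t =
      \sum_i value t (i, None) *: row (enum_rank ((i, None) : var_index)) (tangent t).
    apply/rowP => j; rewrite !mxE summxE raddf_sum; apply: eq_bigr => i _ /=.
    by rewrite mevalM mevalXU !mxE /= enum_rankK /= mul1r.
  by apply: summx_sub => i _; apply/scalemx_sub/row_sub.
have bal i j : balanced i j (mixture_map j).
  apply: (big_ind (balanced i j)) => [|p q|i' _]; last exact: balanced_wmono.
    by rewrite -(mpolyC0 K); apply: balancedC.
  exact: balancedD.
have du i j : mderiv (enum_rank ((i, None) : var_index)) (mixture_map j) = mono i j.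
  rewrite /mixture_map linear_sum (bigD1 i) //= big1 => [|i' i'i].
    by rewrite addr0 mderiv_wmono eqxx.
  by rewrite mderiv_wmono eq_sym (negbTE i'i).
apply/row_subP => l; rewrite -(enum_valK l); case: (enum_val l) => i [l'|].
  suff -> : row (enum_rank ((i, Some l') : var_index)) (jacobian mixture_map t) =
      (value t (i, None) / value t (i, Some l')) *:
        row (enum_rank ((i, Some l') : var_index)) (tangent t).
    exact/scalemx_sub/row_sub.
  apply/rowP => j; rewrite !mxE /= enum_rankK /=.
  have nz : value t (i, Some l') != 0 by apply/lt0r_neq0/t_gt0.
  apply: (mulfI nz); rewrite (balanced_meval t l' (bal i j)) du.
  by rewrite mulrA [X in _ = X * _]mulrCA divff // mulr1 -mulrA [_%:R * _]mulrC.
suff -> : row (enum_rank ((i, None) : var_index)) (jacobian mixture_map t) =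
    row (enum_rank ((i, None) : var_index)) (tangent t) by exact: row_sub.
by apply/rowP => j; rewrite !mxE /= enum_rankK /= du mul1r.
Qed.

End MonomialModels.

Section HadamardMap.
Variables (F : numFieldType) (J : finType) (T : finType) (blk : J -> T).
Variables (n N : nat) (alpha : 'I_n -> 'I_N -> nat).

Local Notation V := (var_index (option J) n).
Local Notation K := #|V|.
Local Notation wmono := (@wmono F (option J) n N alpha).
Local Notation mono := (@mono F (option J) n N alpha).

(* The points indexed by None of all the factors are merged into one: up to the
   torus action all of them but one can be taken to be (1, ..., 1). *)
Definition hadamard_map (j : 'I_N) : mpoly K F :=
  wmono None j * \prod_k (1 + \sum_(p | blk p == k) wmono (Some p) j).

Lemma balanced_hadamard_map i j : balanced alpha i j (hadamard_map j).
Proof.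
have bal1 : balanced alpha i j (1 : mpoly K F) by rewrite -(mpolyC1 K); apply: balancedC.
apply: balancedM; first exact: balanced_wmono.
apply: (big_ind (balanced alpha i j)) => // [p q|k _]; first exact: balancedM.
apply: balancedD => //; apply: (big_ind (balanced alpha i j)) => [|p q|p _].
- by rewrite -(mpolyC0 K); apply: balancedC.
- exact: balancedD.
- exact: balanced_wmono.
Qed.

Lemma meval_mderiv_prod1 K' (I : finType) (t : 'I_K' -> F) l (q : I -> mpoly K' F) :
  (forall i, meval t (q i) = 1) ->
  meval t (\prod_i q i) = 1 /\
  meval t (mderiv l (\prod_i q i)) = \sum_i meval t (mderiv l (q i)).
Proof.
move=> q1.
apply: (big_ind2 (fun p x => meval t p = 1 /\ meval t (mderiv l p) = x)) => //.
  by rewrite meval1 -(mpolyC1 K') mderivC meval0.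
move=> p x r y [p1 px] [r1 ry]; rewrite mevalM p1 r1 mulr1; split=> //.
by rewrite mderivM mevalD !mevalM p1 r1 px ry mulr1 mul1r.
Qed.

Lemma tangent_le_cone_rank (t0 : 'rV[F]_K) : (forall l, 0 < t0 0 l) ->
  exists2 t : 'rV[F]_K, forall l, 0 < t 0 l &
    (\rank (tangent alpha t0) <= cone_rank hadamard_map t)%N.
Proof.
move=> t0_gt0.
(* With these values the weight derivative for [Some p] is [x_0^alpha * (x_p / x_0)^alpha =
   x_p^alpha], the monomial vector of the original point. *)
pose val0 (c : V) := match c with
  | (None, None) => 1
  | (None, Some l) => value t0 (None, Some l)
  | (Some p, None) => 0
  | (Some p, Some l) => value t0 (Some p, Some l) / value t0 (None, Some l)
  end.
pose t1 : 'rV[F]_K := \row_c val0 (enum_val c).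
have t1E c : value t1 c = val0 c by rewrite /value mxE enum_rankK.
(* The coordinate rows use [balanced] to replace coordinate derivatives by weight derivatives,
   divided by the weight. They survive at [t1], where the weights vanish and the Jacobian itself
   loses rank. *)
pose M : 'M[mpoly K F]_(K, N) := \matrix_(l, j) (let c := enum_val l in
  (if c.2 is Some l' then (alpha l' j)%:R else 1) *
    mderiv (enum_rank ((c.1, None) : V)) (hadamard_map j)).
have M_t1 : map_mx (meval (t1 0)) M = tangent alpha t0.
  apply/matrixP => l j; rewrite !mxE /=; case: (enum_val l) => i c /=.
  rewrite mevalM; congr (_ * _).
    by case: c => [l'|]; rewrite ?meval1 // rmorph_nat.
  have q1 k : meval (t1 0) (1 + \sum_(p | blk p == k) wmono (Some p) j) = 1.
    rewrite mevalD meval1 raddf_sum big1 ?addr0 // => p _ /=.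
    by rewrite meval_wmono t1E /= mul0r.
  have [prod1 dprod] := meval_mderiv_prod1 (enum_rank ((i, None) : V)) q1.
  rewrite /hadamard_map mderivM mevalD (mevalM _ (mderiv _ _)) (mevalM _ (wmono _ _)).
  rewrite prod1 dprod mulr1 mderiv_wmono.
  rewrite raddfMn /= meval_mono meval_wmono t1E mul1r.
  have mono0 : \prod_l0 value t1 (None, Some l0) ^+ alpha l0 j = meval (t0 0) (mono None j).
    by rewrite meval_mono; apply: eq_bigr => l' _; rewrite t1E.
  rewrite mono0; under eq_bigr do rewrite mderivD -(mpolyC1 K) mderivC add0r
    (raddf_sum (mderiv _)) (raddf_sum (meval _)).
  rewrite /=; case: i {dprod} => [p|].
    rewrite mulr0n add0r.
    rewrite (eq_bigr (fun k => if blk p == k then meval (t1 0) (mono (Some p) j) else 0)).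
      rewrite -big_mkcond (big_pred1 (blk p)) => [|k]; last by rewrite /= eq_sym.
      rewrite !meval_mono -big_split; apply: eq_bigr => l' _ /=.
      by rewrite !t1E /= -exprMn mulrC divfK // lt0r_neq0 ?t0_gt0.
    move=> k _; case: eqP => [<-|ne].
      rewrite (bigD1 p) //= mderiv_wmono eqxx big1 ?addr0 // => p' /andP[_ ne'].
      by rewrite mderiv_wmono (inj_eq Some_inj) eq_sym (negbTE ne') meval0.
    rewrite big1 // => p' /eqP bp'; rewrite mderiv_wmono (inj_eq Some_inj).
    by case: eqP => [pp'|_]; rewrite ?meval0 //; case: ne; rewrite pp'.
  rewrite big1 ?mulr0 ?addr0 // => k _; rewrite big1 // => p _.
  by rewrite mderiv_wmono meval0.
have [t t_gt0 rk_le] := rank_pos_point M t1; exists t => //.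
rewrite -M_t1; apply: leq_trans rk_le _; apply: mxrankS.
rewrite -addsmxE; apply: submx_trans (addsmxSr _ _).
apply/row_subP => l; rewrite -(enum_valK l); case: (enum_val l) => i [l'|].
  suff -> : row (enum_rank ((i, Some l') : V)) (map_mx (meval (t 0)) M) =
    (value t (i, Some l') / value t (i, None)) *:
        row (enum_rank ((i, Some l') : V)) (jacobian hadamard_map t).
    exact/scalemx_sub/row_sub.
  apply/rowP => j; rewrite !mxE /= enum_rankK /=.
  have nz : value t (i, None) != 0 by apply/lt0r_neq0/t_gt0.
  apply: (mulfI nz); rewrite mulrA [value t (i, None) * (_ / _)]mulrCA divff // mulr1.
  rewrite (balanced_meval t l' (balanced_hadamard_map i j)) mevalM rmorph_nat.
  by rewrite mulrCA mulrC.
suff -> : row (enum_rank ((i, None) : V)) (map_mx (meval (t 0)) M) =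
    row (enum_rank ((i, None) : V)) (jacobian hadamard_map t) by exact: row_sub.
by apply/rowP => j; rewrite !mxE /= enum_rankK /= mul1r.
Qed.

End HadamardMap.

(** * Parametrization of the models *)

Section Models.
Variable R : realType.

Lemma normalizeZ N c (v : 'rV[R]_N) : c != 0 -> normalize (c *: v) = normalize v.
Proof.
move=> nz_c; rewrite /normalize (eq_bigr (fun j => c * v 0 j)) => [|j _]; last by rewrite mxE.
by rewrite -mulr_sumr invfM scalerA mulrAC mulVf // mul1r.
Qed.

Section ExpFamily.
Variables (n N : nat) (A : 'M[int]_(n.+1, N.+1)).

(* Adding a multiple of the all-ones vector to a row of A does not change the
   exponential family, so the exponents may be taken nonnegative. *)
Definition expo l j : nat := `|(A l j + \sum_i `|A l i|)%R|%N.

Definition mvec (x : 'I_n.+1 -> R) : 'rV[R]_N.+1 := \row_j \prod_l x l ^+ expo l j.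

Lemma mvec_gt0 x j : (forall l, 0 < x l) -> 0 < mvec x 0 j.
Proof. by move=> x_gt0; rewrite mxE prodr_gt0 // => l _; rewrite exprn_gt0. Qed.

Lemma sum_mvec_gt0 x : (forall l, 0 < x l) -> 0 < \sum_j mvec x 0 j.
Proof.
move=> x_gt0; rewrite (bigD1 ord0) //= ltr_wpDr ?mvec_gt0 //.
by apply: sumr_ge0 => j _; apply/ltW/mvec_gt0.
Qed.

Lemma exp_familyP (p : 'rV[R]_N.+1) :
  exp_family A p <-> exists2 x, forall l, 0 < x l & p = normalize (mvec x).
Proof.
have H (eta : 'rV[R]_n.+1) : normalize (mvec (fun l => expR (eta 0 l))) =
    normalize (\row_j expR ((eta *m map_mx intr A) 0 j)).
  pose s l := \sum_i `|A l i|.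
  (* The shift of the exponents multiplies all entries by this factor, which normalization
     removes. *)
  pose c := expR (\sum_l eta 0 l * (s l)%:~R).
  rewrite -(@normalizeZ _ c (\row_j _)); last by rewrite gt_eqF ?expR_gt0.
  congr normalize; apply/rowP => j; rewrite !mxE -expRD -big_split expR_sum.
  apply: eq_bigr => l _ /=; rewrite mxE -expRM_natl mulrC -mulrDr; congr (expR (_ * _)).
  rewrite addrC -intrD /expo -[LHS]/(Posz _)%:~R abszE ger0_norm //.
  rewrite /s (bigD1 j) //= addrA; apply: addr_ge0; last exact: sumr_ge0.
  by rewrite -lerBlDl sub0r -normrN ler_norm.
split=> [[eta ->]|[x x_gt0 ->]].
  by exists (fun l => expR (eta 0 l)) => [l|]; rewrite ?expR_gt0.
exists (\row_l ln (x l)); rewrite -H; congr normalize.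
by apply/rowP => j; rewrite !mxE; apply: eq_bigr => l _; rewrite mxE lnK // posrE.
Qed.

Lemma mixture_exp_family r (p : 'rV[R]_N.+1) : mixture r (exp_family A) p ->
  \sum_j p 0 j = 1 /\ exists u : 'I_r -> R, exists x, p = \sum_i u i *: mvec (x i).
Proof.
case=> w [q [w_ge0 w1 qE ->]].
have /choice[x xP] i : exists x, (forall l, 0 < x l) /\ q i = normalize (mvec x).
  by have /exp_familyP[x] := qE i; exists x.
split.
  under eq_bigr do rewrite summxE.
  rewrite exchange_big -[RHS]w1; apply: eq_bigr => i _ /=.
  have [x_gt0 ->] := xP i; under eq_bigr do rewrite mxE [X in _ * X]mxE.
  by rewrite -!mulr_sumr mulVf ?mulr1 // gt_eqF ?sum_mvec_gt0.
exists (fun i => w i / \sum_j mvec (x i) 0 j), x; apply: eq_bigr => i _.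
by have [_ ->] := xP i; rewrite /normalize scalerA.
Qed.

(** Normalizing the point [i] divides it by its total [m i], so the convex weights have to be
    [u i * m i / S]. *)
Lemma mixture_of_mvec (I : finType) r (u : I -> R) (x : I -> 'I_n.+1 -> R) :
  #|I| = r -> (0 < r)%N -> (forall i, 0 < u i) -> (forall i l, 0 < x i l) ->
  mixture r (exp_family A) (normalize (\sum_i u i *: mvec (x i))).
Proof.
move=> cardI r_gt0 u_gt0 x_gt0.
pose b (i : 'I_r) : I := enum_val (cast_ord (esym cardI) i).
pose m i := \sum_j mvec (x i) 0 j.
have m_gt0 i : 0 < m i by exact: sum_mvec_gt0.
pose S := \sum_i u i * m i.
have bE (T : nmodType) (f : I -> T) : \sum_(i < r) f (b i) = \sum_i f i.
  rewrite [RHS](reindex b) //.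
  apply: onW_bij; exists (fun i => cast_ord cardI (enum_rank i)) => i.
    by rewrite /b enum_valK cast_ordKV.
  by rewrite /b cast_ordK enum_rankK.
have S_gt0 : 0 < S.
  pose i0 := b (Ordinal r_gt0).
  rewrite /S (bigD1 i0) //= ltr_wpDr ?mulr_gt0 //.
  by apply: sumr_ge0 => i _; rewrite mulr_ge0 // ltW.
exists (fun i => u (b i) * m (b i) / S), (fun i => normalize (mvec (x (b i)))); split.
- by move=> i; rewrite divr_ge0 ?mulr_ge0 // ltW.
- by rewrite -mulr_suml (bE _ (fun i => u i * m i)) divff ?gt_eqF.
- by move=> i; apply/exp_familyP; exists (x (b i)).
rewrite (bE _ (fun i => (u i * m i / S) *: normalize (mvec (x i)))) /normalize.
have -> : \sum_j (\sum_i u i *: mvec (x i)) 0 j = S.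
  under eq_bigr do rewrite summxE.
  rewrite exchange_big; apply: eq_bigr => i _ /=; rewrite mulr_sumr.
  by apply: eq_bigr => j _; rewrite mxE.
rewrite scaler_sumr; apply: eq_bigr => i _; rewrite !scalerA -/(m i).
by rewrite mulrAC mulfK ?gt_eqF // mulrC.
Qed.

Lemma mixture_param (I : finType) r (p : 'rV[R]_N.+1) :
  #|I| = r -> mixture r (exp_family A) p ->
  let Phi := @mixture_map R I n.+1 N.+1 expo in
  exists2 t : 'rV[R]_#|var_index I n.+1|, meval (t 0) (coord_sum Phi) != 0 &
    forall j, p 0 j = param Phi t j.
Proof.
move=> cardI /mixture_exp_family[p1 [u [x pE]]] Phi.
pose b (i : I) : 'I_r := cast_ord cardI (enum_rank i).
pose vals (c : var_index I n.+1) :=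
  if c.2 is Some l then x (b c.1) l else u (b c.1).
pose t : 'rV[R]_#|var_index I n.+1| := \row_l vals (enum_val l).
have tE c : value t c = vals c by rewrite /value mxE enum_rankK.
have PhiE j : meval (t 0) (Phi j) = p 0 j.
  rewrite pE summxE [RHS](reindex b) /=; last first.
    apply: onW_bij; exists (fun i => enum_val (cast_ord (esym cardI) i)) => i.
      by rewrite /b cast_ordK enum_rankK.
    by rewrite /b enum_valK cast_ordKV.
  rewrite raddf_sum; apply: eq_bigr => i _ /=.
  by rewrite meval_wmono !mxE tE; congr (_ * _); apply: eq_bigr => l _; rewrite tE.
have totE : meval (t 0) (coord_sum Phi) = 1.
  by rewrite raddf_sum -[RHS]p1; apply: eq_bigr => j _; apply: PhiE.
by exists t => [|j]; rewrite ?totE ?oner_eq0 // /param totE divr1 PhiE.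
Qed.

Lemma big_option (T : nmodType) (I : finType) (f : option I -> T) :
  \sum_i f i = f None + \sum_i f (Some i).
Proof.
rewrite (bigD1 None) //=; congr (_ + _).
rewrite (reindex_omap Some id) => [|[]//].
by apply: eq_bigl => i; rewrite eqxx.
Qed.

Lemma hadamard_param m (r : 'I_m -> nat)
    (t : 'rV[R]_#|var_index (option {k : 'I_m & 'I_(r k - 1)}) n.+1|) :
  (0 < m)%N -> (forall k, (1 <= r k)%N) -> (forall l, 0 < t 0 l) ->
  hadamard (fun k => mixture (r k) (exp_family A))
    (\row_j param (hadamard_map R (fun p : {k : 'I_m & 'I_(r k - 1)} => tag p) expo) t j).
Proof.
move=> m_gt0 r_gt0 t_gt0; set Psi := hadamard_map _ _ _.
have v_gt0 c : 0 < value t c by exact: t_gt0.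
(* One factor carries the merged leading point; in the other factors the leading point is
   [(1, ..., 1)] with weight 1. In every factor the remaining points are taken relative to its
   leading point. *)
pose k0 := Ordinal m_gt0.
pose u0 k := if k == k0 then value t (None, None) else 1.
pose x0 k l := if k == k0 then value t (None, Some l) else 1.
have u0_gt0 k : 0 < u0 k by rewrite /u0; case: ifP.
have x0_gt0 k l : 0 < x0 k l by rewrite /x0; case: ifP.
pose idx k (i : 'I_(r k - 1)) : option {k : 'I_m & 'I_(r k - 1)} := Some (Tagged _ i).
pose u k (i : option 'I_(r k - 1)) := u0 k * (if i is Some i' then value t (idx k i', None) else 1).
pose x k (i : option 'I_(r k - 1)) l :=
  x0 k l * (if i is Some i' then value t (idx k i', Some l) else 1).
pose v k := \sum_i u k i *: mvec (x k i).
exists (fun k => normalize (v k)) => [k|].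
  apply: mixture_of_mvec => //; first by rewrite card_option card_ord subn1 prednK.
    by case=> [i|]; rewrite /u mulr_gt0.
  by case=> [i|] l; rewrite /x mulr_gt0.
have vE k j : v k 0 j = u0 k * mvec (x0 k) 0 j *
    meval (t 0) (1 + \sum_(p : {k : 'I_m & 'I_(r k - 1)} | tag p == k)
      @wmono R _ n.+1 N.+1 expo (Some p) j).
  have mvecM y z : mvec (fun l => y l * z l) 0 j = mvec y 0 j * mvec z 0 j.
    by rewrite !mxE -big_split; apply: eq_bigr => l _; rewrite exprMn.
  have mvec1 : mvec (fun=> 1) 0 j = 1 by rewrite mxE big1 // => l _; rewrite expr1n.
  rewrite mevalD meval1 raddf_sum mulrDr mulr1 /v summxE big_option; congr (_ + _).
    rewrite mxE /u mulr1; congr (_ * _).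
    by rewrite [LHS](mvecM (x0 k) (fun=> 1)) mvec1 mulr1.
  rewrite (eq_bigl (fun p => (tag p == k) && true)) => [|p]; last by rewrite andbT.
  rewrite (eq_bigr (fun p => meval (t 0) (@wmono R _ n.+1 N.+1 expo (idx _ (tagged p)) j)));
    last by case.
  rewrite -(sig_big_dep (pred1 k) (fun _ _ => true)
    (fun k i => meval (t 0) (@wmono R _ n.+1 N.+1 expo (idx k i) j))) big_pred1_eq mulr_sumr.
  apply: eq_bigr => i _; rewrite mxE /u meval_wmono.
  rewrite [X in _ * X](mvecM (x0 k) (fun l => value t (idx k i, Some l))).
  rewrite -!mulrA; congr (_ * _); rewrite mulrCA; do 2 congr (_ * _).
  by rewrite mxE.
have PsiE j : meval (t 0) (Psi j) = \prod_k v k 0 j.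
  rewrite (eq_bigr _ (fun k _ => vE k j)) big_split /Psi mevalM rmorph_prod.
  congr (_ * _); rewrite (bigD1 k0) //= big1 => [|k /negbTE kk0].
    by rewrite mulr1 /u0 /x0 eqxx meval_wmono mxE.
  rewrite /u0 /x0 kk0 mul1r mxE big1 // => l _; exact: expr1n.
(* The product of the normalized factors differs from [Psi] by this scalar and the total of [Psi],
   both absorbed by the final normalization. *)
have nz : \prod_k (\sum_j v k 0 j)^-1 != 0.
  apply/prodf_neq0 => k _; rewrite invr_eq0 gt_eqF //.
  have vj_gt0 j : 0 < v k 0 j.
    have gt0 i : 0 < (u k i *: mvec (x k i)) 0 j.
      rewrite mxE mulr_gt0 ?mvec_gt0 //; first by case: i => [i|]; rewrite mulr_gt0.
      by move=> l; case: i => [i|]; rewrite mulr_gt0.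
    by rewrite summxE (bigD1 None) //= ltr_wpDr // sumr_ge0 // => i _; apply/ltW.
  by rewrite (bigD1 ord0) //= ltr_wpDr // sumr_ge0 // => j _; apply/ltW.
rewrite (_ : \row_j \prod_k _ = (\prod_k (\sum_j v k 0 j)^-1) *: \row_j meval (t 0) (Psi j)).
  rewrite normalizeZ //; apply/rowP => j; rewrite !mxE /param mulrC; congr (_^-1 * _).
  by rewrite raddf_sum; apply: eq_bigr => i _; rewrite mxE.
apply/rowP => j; rewrite !mxE PsiE -big_split; apply: eq_bigr => k _ /=.
by rewrite mxE.
Qed.

End ExpFamily.
End Models.

(** * Krull dimension against cone rank, and the comparison *)

(** Choose [f i] in [P i.+1] outside [P i]. If [d] reached the rank, a nontrivial relation between
    the [f i] would vanish on [S], hence lie in [P 0], against [prime_chain_free]. *)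
Lemma prime_chain_le_cone_rank (R : realType) (K n : nat) (Psi : 'I_n -> mpoly K R)
    (S : set 'rV[R]_n) (t0 : 'rV[R]_K) d (P : nat -> {pred mpoly n R}) :
  (forall p, S p ->
    exists2 t : 'rV[R]_K, meval (t 0) (coord_sum Psi) != 0 & forall j, p 0 j = param Psi t j) ->
  meval (t0 0) (coord_sum Psi) != 0 -> (forall t, cone_rank Psi t <= cone_rank Psi t0)%N ->
  prime_chain (vanishing_ideal S) d P -> (d < cone_rank Psi t0)%N.
Proof.
move=> hS nz0 rk_le [idP stP].
have rk_gt0 : (0 < cone_rank Psi t0)%N.
  rewrite lt0n mxrank_eq0; apply: contraNneq nz0 => M0.
  rewrite raddf_sum big1 // => j _ /=.
  have := congr1 (fun M : 'M[R]_(1 + K, n) => M (lshift K 0) j) M0.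
  by rewrite col_mxEu !mxE.
have rkE : cone_rank Psi t0 = (cone_rank Psi t0).-1.+1 by rewrite prednK.
rewrite ltnNge; apply/negP => lt_d.
have /choice[f hf] i : exists f, (i < d)%N -> f \in P i.+1 /\ f \notin P i.
  have [lt_id|_] := ltnP i d; last by exists 0.
  by have [_ [f ? ?]] := stP i lt_id; exists f.
have [||D [c [e nzc] van]] := dependent_of_cone_rank (d := d) f nz0 rkE.
- by move=> t; rewrite -rkE.
- by move: lt_d; rewrite {1}rkE.
have c0 : c e = 0.
  apply: (prime_chain_free (P := P) (f := f)) => [i le_id|i lt_id|].
  - by have [? ? _] := idP i le_id.
  - by have [? _] := stP i lt_id; have [] := hf i lt_id.
  have [_ _ sub] := idP 0%N (leq0n d); apply: sub.
  apply: asboolT => p /hS[t nz pE].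
  by rewrite (meval_eq _ pE); apply: van.
by rewrite c0 eqxx in nzc.
Qed.

(** [S] is only known to contain the points with positive parameters. They suffice: after clearing
    denominators, a polynomial vanishing there pulls back to one vanishing on the positive orthant,
    hence to zero. *)
Lemma prime_chain_of_cone_rank (R : realType) (K n : nat) (Psi : 'I_n -> mpoly K R)
    (S : set 'rV[R]_n) (t0 : 'rV[R]_K) d :
  (forall t : 'rV[R]_K, (forall l, 0 < t 0 l) -> meval (t 0) (coord_sum Psi) != 0) ->
  (forall t : 'rV[R]_K, (forall l, 0 < t 0 l) -> S (\row_j param Psi t j)) ->
  (forall l, 0 < t0 0 l) -> (d < cone_rank Psi t0)%N ->
  exists P, prime_chain (vanishing_ideal S) d P.
Proof.
move=> nz hS t0_gt0 /(slice_chain (nz t0 t0_gt0))[P [idP vanP stP]].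
exists P; split=> [i _|//]; have [? ?] := idP i; split=> // f.
move=> /asboolW f_van; apply: vanP => t nzt.
pose H := homog_eval (msize f) (@mpolyC K R) Psi (coord_sum Psi) f.
have HE (v : 'rV[R]_K) : meval (v 0) (coord_sum Psi) != 0 ->
    meval (v 0) H = meval (v 0) (coord_sum Psi) ^+ msize f * meval (param Psi v) f.
  move=> nzv; rewrite rmorph_homog_eval.
  rewrite (@eq_homog_eval _ _ _ _ _ idfun _ (fun j => meval (v 0) (Psi j)) _
    (meval (v 0) (coord_sum Psi))) => [|x|//|//]; last exact: mevalC.
  by rewrite homog_evalE.
have H0 : H = 0.
  apply: mpoly_eq0_of_pos => v v_gt0; pose w : 'rV[R]_K := \row_l v l.
  have w_gt0 l : 0 < w 0 l by rewrite mxE.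
  have wv : w 0 =1 v by move=> l; rewrite mxE.
  rewrite -(meval_eq _ wv) HE ?nz //.
  have := f_van _ (hS w w_gt0).
  by rewrite (@meval_eq _ _ _ (param Psi w)) => [->|j]; rewrite ?mulr0 ?mxE.
have /eqP := HE t nzt; rewrite H0 meval0 eq_sym mulf_eq0 expf_eq0 (negbTE nzt) andbF.
by move/eqP.
Qed.

Theorem corollary4p5 (R : realType) (n N : nat) (A : 'M[int]_(n.+1, N.+1))
  (m : nat) (hm : (0 < m)%N) (r : 'I_m -> nat) (hr : forall k, (1 <= r k)%N) :
  (semialg_dim (mixture (\sum_(k < m) (r k - 1) + 1)%N (@exp_family R n N A))
   <= semialg_dim (hadamard (fun k => mixture (r k) (@exp_family R n N A))))%E.
Proof.
pose J : finType := {k : 'I_m & 'I_(r k - 1)}.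
(* One merged leading point and [r k - 1] further points for each factor: both maps use the same
   parameter space. *)
have cardJ : #|{: option J}| = (\sum_(k < m) (r k - 1) + 1)%N.
  by rewrite card_option card_tagged sumnE big_map big_enum addn1 /=;
    under eq_bigr do rewrite card_ord.
pose K := #|var_index (option J) n.+1|.
pose Phi := mixture_map R (option J) (expo A).
pose Psi := hadamard_map R (fun p : J => tag p) (expo A).
have tot_gt0 (Q : 'I_N.+1 -> mpoly K R) (t : 'rV[R]_K) :
    (forall j, 0 < meval (t 0) (Q j)) -> meval (t 0) (coord_sum Q) != 0.
  move=> Q_gt0; rewrite raddf_sum gt_eqF // (bigD1 ord0) //= ltr_wpDr ?Q_gt0 //.
  by apply: sumr_ge0 => j _; apply/ltW/Q_gt0.
have wmono_gt0 (t : 'rV[R]_K) i j : (forall l, 0 < t 0 l) ->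
    0 < meval (t 0) (@wmono R (option J) _ _ (expo A) i j).
  move=> t_gt0; rewrite meval_wmono mulr_gt0 ?t_gt0 // prodr_gt0 // => l _.
  by rewrite exprn_gt0 ?t_gt0.
have Phi_gt0 (t : 'rV[R]_K) : (forall l, 0 < t 0 l) -> forall j, 0 < meval (t 0) (Phi j).
  move=> t_gt0 j; rewrite raddf_sum (bigD1 None) //= ltr_wpDr ?wmono_gt0 //.
  by apply: sumr_ge0 => i _; apply/ltW/wmono_gt0.
have Psi_gt0 (t : 'rV[R]_K) : (forall l, 0 < t 0 l) -> forall j, 0 < meval (t 0) (Psi j).
  move=> t_gt0 j; rewrite mevalM mulr_gt0 ?wmono_gt0 // rmorph_prod prodr_gt0 // => k _.
  rewrite /= mevalD meval1 raddf_sum ltr_wpDr ?ltr01 //.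
  by apply: sumr_ge0 => i _; apply/ltW/wmono_gt0.
(* The rank is bounded by the number of columns, so a maximum exists; it is then moved to a positive
   point. *)
have [t0 t0_max] : exists t0, forall t, (cone_rank Phi t <= cone_rank Phi t0)%N.
  have exk : exists k, `[< exists t, cone_rank Phi t = k >].
    by exists (cone_rank Phi 0); apply/asboolP; exists 0.
  have bdk k : `[< exists t, cone_rank Phi t = k >] -> (k <= N.+1)%N.
    by move=> /asboolP[t <-]; apply: rank_leq_col.
  case: (ex_maxnP exk bdk) => k /asboolP[t0 <-] max_k; exists t0 => t.
  by apply: max_k; apply/asboolP; exists t.
have [t1 t1_gt0 t0t1] := cone_rank_le_pos Phi t0.
have t1_max t : (cone_rank Phi t <= cone_rank Phi t1)%N by exact: leq_trans (t0_max t) t0t1.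
have [t2 t2_gt0 t1t2] := tangent_le_cone_rank (fun p : J => tag p) (expo A) t1_gt0.
(* Chain lengths carry over one by one: [d] is below the rank of [Phi] at [t1], hence below that of
   [tangent] at [t1] and of [Psi] at [t2]. *)
apply: ereal_sup_le => _ [d [P chainP] <-]; exists d => //=.
apply: (@prime_chain_of_cone_rank R K _ Psi _ t2) => //.
- by move=> t t_gt0; apply/tot_gt0/Psi_gt0.
- by move=> t t_gt0; apply: hadamard_param.
apply: leq_trans t1t2; apply: leq_trans (cone_rank_mixture_map (expo A) t1_gt0).
apply: prime_chain_le_cone_rank t1_max chainP; last exact/tot_gt0/Phi_gt0.
by move=> p /(mixture_param cardJ).
Qed.
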